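(* Let $E$ be a locally compact second countable Hausdorff space and let $\eta$ be a Poisson point process on $E$ with finite intensity measure, i.e. $\mathbb{E}\,\eta(E)<\infty$. Then for every measurable subset $A\subset \bar N(E)$ and every $s\ge 0$, $$\mathbb{P}(\eta\in A)\;\mathbb{P}\left(\eta\notin A_s^\pi\right)\le e^{-\frac{s^2}{4}},$$ where $A_s^\pi=\{\xi\in\bar N(E): d_T^\pi(\xi,A)\le s\}$ and $$d_T^\pi(\xi,A)=\sup_{\alpha}\ \inf_{\nu\in A}\int \alpha\, d(\xi\backslash\nu),$$ the supremum being over all nonnegative functions $\alpha:E\to\mathbb{R}$ with $\|\alpha\|_{2,\xi}^2\le 1$.
   Context: $E$ carries its Borel $\sigma$-algebra. $\bar N(E)$ denotes the set of all finite counting measures $\xi=\sum_{i=1}^k\delta_{x_i}$ with $k\in\mathbb{N}_0$, $x_i\in E$ (equivalently, finite point sets in $E$ with multiplicity), equipped with the usual $\sigma$-algebra generated by the maps $\xi\mapsto\xi(B)$, $B\subset E$ measurable. Write $\xi(x)$ for the multiplicity $\xi(\{x\})$. For $\xi\in\bar N(E)$ and $\alpha:E\to\mathbb{R}$, $\|\alpha\|_{2,\xi}^2=\int\alpha^2\,d\xi=\sum_{x:\,\xi(x)>0}\xi(x)\alpha(x)^2$. For $\xi,\nu\in\bar N(E)$ the (set-)difference is the counting measure $$\xi\backslash\nu=\sum_{x:\,\xi(x)>0}(\xi(x)-\nu(x))_+\,\delta_x,$$ where $a_+=\max(a,0)$. Integrals against counting measures in $\bar N(E)$ are finite sums. The infimum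 over the empty set is $+\infty$. A Poisson point process $\eta$ on $E$ with finite intensity measure $\Lambda(B)=\mathbb{E}\,\eta(B)$ is a random element of $\bar N(E)$ such that $\eta(B)$ is Poisson distributed with mean $\Lambda(B)$ for each measurable $B$ and $\eta(B_1),\dots,\eta(B_m)$ are independent for pairwise disjoint measurable $B_1,\dots,B_m$. The probability $\mathbb{P}(\eta\notin A_s^\pi)$ is understood with respect to the completion of the law of $\eta$. *)

(* Defs.v *)
From HB Require Import structures.
From mathcomp Require Import all_boot all_order all_algebra.
From mathcomp Require Import finmap multiset.
From mathcomp Require Import all_classical all_reals all_analysis.

Set Implicit Arguments.
Unset Strict Implicit.
Unset Printing Implicit Defensive.

Import Order.TTheory GRing.Theory Num.Theory.
Import numFieldNormedType.Exports.

Local Open Scope classical_set_scope.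
Local Open Scope ring_scope.

Definition borel (E : topologicalType) : set (set E) := <<s (@open E) >>.

(* A finite counting measure xi = \sum_i \d_(x_i) is encoded by the finite
   multiset of its atoms: [xi x] is the multiplicity xi({x}), and the truncated
   difference [xi `\` nu] of multisets is the difference of counting measures. *)
Definition fcmeasure (E : topologicalType) : Type := multiset E.

Section counting_measures.
Variable E : topologicalType.

Definition fcmass (xi : fcmeasure E) (B : set E) : nat :=
  (\sum_(x <- finsupp (xi : multiset E) | x \in B) (xi : multiset E) x)%N.

Definition fcdiff (xi nu : fcmeasure E) : fcmeasure E :=
  ((xi : multiset E) `\` (nu : multiset E))%mset.

Definition fcintegral (R : realType) (xi : fcmeasure E) (f : E -> R) : R :=
  \sum_(x <- finsupp (xi : multiset E)) ((xi : multiset E) x)%:R * f x.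

(* preimages of arbitrary sets of naturals under the maps xi |-> xi(B) *)
Definition fcmass_events : set (set (fcmeasure E)) :=
  [set S | exists B (U : set nat),
    borel B /\ S = [set xi | U (fcmass xi B)]].

HB.instance Definition _ := Choice.on (fcmeasure E).
HB.instance Definition _ :=
  isPointed.Build (fcmeasure E) (mset0 : multiset E).
HB.instance Definition _ := @isMeasurable.Build (sigma_display fcmass_events)
  (fcmeasure E) <<s fcmass_events >>
  (@sigma_algebra0 _ setT fcmass_events) (@sigma_algebraC _ fcmass_events)
  (@sigma_algebra_bigcup _ setT fcmass_events).

End counting_measures.

Section poisson_process.
Context (E : topologicalType) (R : realType).
Context (d : measure_display) (Omega : measurableType d).
Context (P : probability Omega R) (eta : {RV P >-> fcmeasure E}).

Definition intensity (B : set E) : \bar R :=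
  'E_P[fun w => (fcmass (eta w) B)%:R].

(* The second argument of [poisson_prob] is a dummy; the Poisson distribution
   with mean 0 is the Dirac mass at 0. *)
Definition poisson_counts : Prop :=
  forall (B : set E) (U : set nat), borel B ->
    P [set w | U (fcmass (eta w) B)] =
    poisson_prob (fine (intensity B)) 0%N U.

Definition independent_counts : Prop :=
  forall (m : nat) (B : 'I_m -> set E),
    (forall i, borel (B i)) -> trivIset [set: 'I_m] B ->
    forall U : 'I_m -> set nat,
      P [set w | forall i, U i (fcmass (eta w) (B i))] =
      (\prod_(i < m) P [set w | U i (fcmass (eta w) (B i))])%E.

Definition finite_poisson_process : Prop :=
  [/\ (intensity [set: E] < +oo)%E, poisson_counts & independent_counts].

End poisson_process.

Section convex_distance.
Context (E : topologicalType) (R : realType).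

Definition convex_distance (xi : fcmeasure E) (A : set (fcmeasure E)) : \bar R :=
  ereal_sup
    [set ereal_inf [set (fcintegral (fcdiff xi nu) alpha)%:E | nu in A]
    | alpha in [set alpha : E -> R | (forall x, 0 <= alpha x) /\
                  fcintegral xi (fun x => alpha x ^+ 2) <= 1]].

Definition enlargement (A : set (fcmeasure E)) (s : R) : set (fcmeasure E) :=
  [set xi | (convex_distance xi A <= s%:E)%E].

End convex_distance.

(* The outer measure of mu: on a set B `|` N of [completed_algebra_gen mu], with
   B measurable and N negligible, its value is mu B. *)
Definition completed_prob (d : measure_display) (T : measurableType d)
    (R : realType) (mu : probability T R) (S : set T) : \bar R :=
  @completed_measure_extension d T R mu S.

(* Main.v *)
(** Talagrand's induction is run on a finite family of independent Bernoulli
    slots, each of which may add one point to a given cell.  Distances are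
    measured directly between the vectors of cell counts.  Refining the slots
    gives independent Poisson counts, hence the inequality for the counts of a
    Poisson process on a finite partition into Borel sets.

    To reach an arbitrary measurable [A], a finite counting measure is coded by
    its masses on a countable base of open sets, a point of the Baire space.
    By local compactness the set of codes of points of [E] is analytic, so all
    measurable sets of counting measures, and their enlargements, have analytic
    codes.  Analytic sets are capacitable: they are measurable for the
    completion, and [A] has subsets of almost full measure which are decreasing
    intersections of sets [K n] determined by the counts on the n-th partition,
    with a compact set of codes.  By compactness a measure outside the
    enlargement of [A] is, at all fine enough levels, far from [K n] in terms of
    the counts alone, so the discrete inequality passes to the limit. *)

From HB Require Import structures.
From mathcomp Require Import all_boot all_order all_algebra.
From mathcomp Require Import finmap multiset.
From mathcomp Require Import all_classical all_reals all_analysis.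
From mathcomp Require Import measurable_realfun.
From mathcomp Require Import ring lra.
Require Import Defs.

Set Implicit Arguments.
Unset Strict Implicit.
Unset Printing Implicit Defensive.

Import Order.TTheory GRing.Theory Num.Theory.
Import numFieldNormedType.Exports.

Local Open Scope classical_set_scope.
Local Open Scope ring_scope.

(** * Talagrand's inequality for Bernoulli slots *)

(** The counts on finitely many cells see [A] only through a projection, and at every level the
    projection of a general [A] may contain count vectors close to a measure that is far from [A].
    This is why [A] is first shrunk to a part with compact codes: there, closeness at all levels
    produces an actual member of [A].

    The enlargement involves an uncountable supremum and infimum, so its measurability is not clear.
    It is however a projection: a measure belongs to it when suitable submeasures of it extend to
    members of [A]. Analytic sets are stable under projection, and they are still measurable for the
    completion.

    For 0-1 slots the induction has only two cases, an empty and an occupied slot. The distance is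
    one-sided: points of [nu] in excess of [xi] are free. Hence an empty slot may be compared with
    the union of [A] and its section, just as an occupied one.

    The constant 4 is the one in the moment [expR (q / 4)]. With it, the interpolation error
    [(1 - l)^2] of the occupied slot can be balanced against the ratio [a / b] of two probabilities,
    at a price of at most [2 - a / b]. *)

Section bernoulli_slots.
Context {R : realType} {I : finType}.
Implicit Types (st : seq (I * R)) (S : seq bool) (F G : seq bool -> R).
Implicit Types (xi nu : {ffun I -> nat}) (A : set {ffun I -> nat}).

Definition incr (i : I) nu : {ffun I -> nat} := [ffun j => (i == j) + nu j]%N.

Fixpoint slots_mean st F : R :=
  if st is (i, p) :: st' then
    (1 - p) * slots_mean st' (fun S => F (false :: S)) +
    p * slots_mean st' (fun S => F (true :: S))
  else F [::].

Fixpoint slots_count st S : {ffun I -> nat} :=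
  match st, S with
  | (i, _) :: st', b :: S' =>
      if b then incr i (slots_count st' S') else slots_count st' S'
  | _, _ => [ffun=> 0%N]
  end.

Definition slots_ok st := all (fun ip : I * R => 0 <= ip.2 <= 1) st.

Definition slots_prob st A : R :=
  slots_mean st (fun S => (slots_count st S \in A)%:R).

Lemma slots_mean_le st F G : slots_ok st -> (forall S, F S <= G S) ->
  slots_mean st F <= slots_mean st G.
Proof.
elim: st F G => [|[i p] st IH] F G //= /andP[/andP[p0 p1] ok] FG.
by apply: lerD; apply: ler_wpM2l; rewrite ?subr_ge0//; apply: IH.
Qed.

Lemma slots_mean_eq st F G : F =1 G -> slots_mean st F = slots_mean st G.
Proof. by move=> /funext ->. Qed.

Lemma slots_mean_cst st (c : R) : slots_mean st (fun=> c) = c.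
Proof. by elim: st => [|[i p] st IH] //=; rewrite IH; ring. Qed.

Lemma slots_meanD st F G :
  slots_mean st (fun S => F S + G S) = slots_mean st F + slots_mean st G.
Proof. by elim: st F G => [|[i p] st IH] F G //=; rewrite !IH; ring. Qed.

Lemma slots_meanZ st (c : R) F :
  slots_mean st (fun S => c * F S) = c * slots_mean st F.
Proof. by elim: st F => [|[i p] st IH] F //=; rewrite !IH; ring. Qed.

Lemma slots_mean_ge0 st F : slots_ok st -> (forall S, 0 <= F S) ->
  0 <= slots_mean st F.
Proof. by move=> ok F0; rewrite -(slots_mean_cst st 0); exact: slots_mean_le. Qed.

Lemma slots_prob_ge0 st A : slots_ok st -> 0 <= slots_prob st A.
Proof. by move=> ok; apply: slots_mean_ge0 => // S; rewrite ler0n. Qed.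

Lemma le_slots_prob st A B : slots_ok st -> A `<=` B ->
  slots_prob st A <= slots_prob st B.
Proof.
move=> ok AB; apply: slots_mean_le => // S; rewrite ler_nat.
by case: (boolP (_ \in A)) => //; rewrite inE => /AB/mem_set ->.
Qed.

Lemma slots_prob_set0 st : slots_prob st set0 = 0.
Proof.
rewrite /slots_prob -(slots_mean_cst st 0); apply: slots_mean_eq => S.
by rewrite in_set0.
Qed.

Definition cost (alpha : I -> R) xi nu : R :=
  \sum_i alpha i * (xi i - nu i)%:R.

Definition sqnorm (alpha : I -> R) xi : R := \sum_i (xi i)%:R * alpha i ^+ 2.

(* By minimax, the least admissible [q] is the squared convex distance from
   [xi] to [A]; quantifying over lower bounds [z] avoids taking infima. *)
Definition sqdist_le A xi (q : R) : Prop :=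
  forall (alpha : I -> R) (z : R), (forall i, 0 <= alpha i) -> 0 <= z ->
    (forall nu, A nu -> z <= cost alpha xi nu) ->
    z ^+ 2 <= q * sqnorm alpha xi.

Lemma sqnorm_ge0 alpha xi : 0 <= sqnorm alpha xi.
Proof. by apply: sumr_ge0 => i _; rewrite mulr_ge0// sqr_ge0. Qed.

Lemma sqnorm_incr alpha i xi :
  sqnorm alpha (incr i xi) = alpha i ^+ 2 + sqnorm alpha xi.
Proof.
rewrite /sqnorm (bigD1 i)//= [X in _ = _ + X](bigD1 i)//= ffunE eqxx.
rewrite natrD mulrDl mul1r -addrA; congr (_ + (_ + _)); apply: eq_bigr => j ji.
by rewrite ffunE eq_sym (negPf ji).
Qed.

Lemma cost_incr2 alpha i xi nu : cost alpha (incr i xi) (incr i nu) = cost alpha xi nu.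
Proof. by apply: eq_bigr => j _; rewrite !ffunE subnDl. Qed.

Lemma cost_incrl alpha i xi nu : (forall j, 0 <= alpha j) ->
  cost alpha (incr i xi) nu <= alpha i + cost alpha xi nu.
Proof.
move=> a0; rewrite /cost (bigD1 i)//= [X in _ <= _ + X](bigD1 i)//= ffunE eqxx.
rewrite addrA; apply: lerD; last first.
  by apply: ler_sum => j ji; rewrite ffunE eq_sym (negPf ji).
rewrite -[X in X + _]mulr1 -mulrDr; apply: ler_wpM2l => //.
by rewrite -(natrD _ 1) ler_nat add1n leq_subLR addnS -maxnE ltnS leq_maxr.
Qed.

Lemma cost_incrr alpha i xi nu : (forall j, 0 <= alpha j) ->
  cost alpha xi (incr i nu) <= cost alpha xi nu.
Proof.
move=> a0; apply: ler_sum => j _; apply: ler_wpM2l => //.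
by rewrite ler_nat ffunE leq_sub2l// leq_addl.
Qed.

(** The step for an empty slot: one more point in [nu] never raises the cost, so a lower bound valid
    on [A] is also valid on its section at [i]. *)
Lemma sqdist_le_incr A i xi q : 0 <= q ->
  sqdist_le (A `|` [set nu | A (incr i nu)]) xi q -> sqdist_le A xi q.
Proof.
move=> q0 dB alpha z a0 z0 zA; apply: dB => // nu [|] Anu; first exact: zA.
by apply: le_trans (zA _ Anu) _; exact: cost_incrr.
Qed.

(** The step for an occupied slot: mix, with weights [l] and [1 - l], vectors that share the new
    point and vectors for which it costs [alpha i], then apply Cauchy-Schwarz. The data on [q1] are
    asked for only when [0 < l], because the section of [A] may be empty and then no finite [q1]
    exists. *)
Lemma sqdist_le_convex A i xi q0 q1 l : 0 <= q0 -> 0 <= l <= 1 ->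
  (0 < l -> 0 <= q1 /\ sqdist_le [set nu | A (incr i nu)] xi q1) ->
  sqdist_le (A `|` [set nu | A (incr i nu)]) xi q0 ->
  sqdist_le A (incr i xi) ((1 - l) ^+ 2 + l * q1 + (1 - l) * q0).
Proof.
move=> q00 /andP[l0 l1] d1 d0 alpha z a0 z0 zA.
rewrite sqnorm_incr; set Z := sqnorm alpha xi; set a := alpha i.
have a_ge0 : 0 <= a by exact: a0.
have Z0 : 0 <= Z by exact: sqnorm_ge0.
(* What remains of [z] after paying [a] for the new point, cut off at 0 because [sqdist_le] speaks
   of nonnegative bounds. *)
pose y := Num.max (z - a) 0.
have y0 : 0 <= y by rewrite le_max lexx orbT.
have zy : z <= y + a by rewrite -lerBlDr le_max lexx.
have y2 : y ^+ 2 <= q0 * Z.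
  apply: d0 => // nu Bnu.
  have c0 : 0 <= cost alpha xi nu by apply: sumr_ge0 => j _; rewrite mulr_ge0.
  rewrite ge_max c0 andbT lerBlDl; case: Bnu => [Anu|A1nu].
    by apply: le_trans (zA _ Anu) _; exact: cost_incrl.
  by rewrite (le_trans (zA _ A1nu))// cost_incr2 lerDr.
have lz2 : l * z ^+ 2 <= l * (q1 * Z).
  move: l0; rewrite le_eqVlt => /orP[/eqP <-|l0]; first by rewrite !mul0r.
  apply: ler_wpM2l; first exact: ltW.
  apply: (d1 l0).2 => // nu A1nu.
  by rewrite (le_trans (zA _ A1nu))// cost_incr2.
pose X := l * z + (1 - l) * y; pose q := l * q1 + (1 - l) * q0.
have l'0 : 0 <= 1 - l by rewrite subr_ge0.
have lq0 : 0 <= l * q1.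
  move: l0; rewrite le_eqVlt => /orP[/eqP <-|l0]; first by rewrite !mul0r.
  by rewrite mulr_ge0 ?(ltW l0)//; case: (d1 l0).
have q_ge0 : 0 <= q by rewrite addr_ge0// mulr_ge0.
have X0 : 0 <= X by rewrite addr_ge0 ?mulr_ge0.
have X2 : X ^+ 2 <= q * Z.
  rewrite (@le_trans _ _ (l * z ^+ 2 + (1 - l) * y ^+ 2))//.
    have : 0 <= l * (1 - l) * (z - y) ^+ 2 by rewrite mulr_ge0 ?sqr_ge0// mulr_ge0.
    rewrite /X; nra.
  by rewrite /q [leRHS]mulrDl -!mulrA lerD//; exact: ler_wpM2l.
have zX : z <= X + (1 - l) * a.
  have : (1 - l) * z <= (1 - l) * (y + a) by exact: ler_wpM2l.
  rewrite /X; lra.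
pose b := (1 - l) * a.
have b0 : 0 <= b by rewrite mulr_ge0.
(* The cross term of [(X + b)^2 <= (q + (1 - l)^2) * (Z + a^2)]; after squaring it follows from
   [X^2 <= q * Z] and the inequality of arithmetic and geometric means. *)
have XB : 2 * (X * b) <= q * a ^+ 2 + (1 - l) ^+ 2 * Z.
  rewrite -(@ler_pXn2r _ 2)// ?nnegrE; last 2 first.
  - by rewrite !mulr_ge0.
  - by rewrite addr_ge0// mulr_ge0// sqr_ge0.
  have h1 : (X * b) ^+ 2 <= (q * a ^+ 2) * ((1 - l) ^+ 2 * Z).
    have -> : q * a ^+ 2 * ((1 - l) ^+ 2 * Z) = (q * Z) * b ^+ 2 by rewrite /b; ring.
    by rewrite exprMn; apply: ler_wpM2r; rewrite ?sqr_ge0.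
  have h2 := sqr_ge0 (q * a ^+ 2 - (1 - l) ^+ 2 * Z).
  by lra.
apply: (@le_trans _ _ ((X + b) ^+ 2)).
  by apply: lerXn2r => //; rewrite nnegrE// addr_ge0.
have -> : ((1 - l) ^+ 2 + l * q1 + (1 - l) * q0) * (a ^+ 2 + Z) =
  q * a ^+ 2 + (1 - l) ^+ 2 * Z + q * Z + b ^+ 2 by rewrite /q /b; ring.
by lra.
Qed.

End bernoulli_slots.

(** * Scalar inequalities for the induction step *)

Section talagrand_scalar.
Context {R : realType}.

Lemma expR_convex_comb (l x y : R) : 0 <= l <= 1 ->
  expR (l * x + (1 - l) * y) <= l * expR x + (1 - l) * expR y.
Proof.
move=> /andP[l0 l1]; set m := _ + _ * y.
have tangent z : expR m * (1 + (z - m)) <= expR z.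
  have -> : expR z = expR m * expR (z - m) by rewrite -expRD; congr expR; ring.
  by rewrite ler_wpM2l ?expR_ge0//; exact: expR_ge1Dx.
have hx : l * (expR m * (1 + (x - m))) <= l * expR x by exact: ler_wpM2l.
have hy : (1 - l) * (expR m * (1 + (y - m))) <= (1 - l) * expR y.
  by apply: ler_wpM2l => //; rewrite subr_ge0.
have -> : expR m = l * (expR m * (1 + (x - m))) + (1 - l) * (expR m * (1 + (y - m))).
  by rewrite /m; ring.
exact: lerD.
Qed.

(** For [r = expR (- t)] and [l = 1 - 2 * t], the left side is [r^(-l) * expR ((1 - l)^2 / 4)] and
    the right side is [2 - r]. Multiplied by [w = expR (- t)], the claim reads
    [expR (- t^2) <= 1 - (1 - w)^2]. Both sides are compared with [(1 + t^2)^-1], using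
    [1 - w <= t - t^2 / 4], which comes from [w >= (1 - t / 2)^2]. *)
Lemma expR_sub_sqr_le (t : R) : 0 <= t <= 2^-1 ->
  expR (t - t ^+ 2) <= 2 - expR (- t).
Proof.
move=> /andP[t0 t2]; set w := expR (- t).
have w0 : 0 < w by exact: expR_gt0.
have w1 : w <= 1 by rewrite -expR0 ler_expR oppr_le0.
have wlb : (1 - t / 2) ^+ 2 <= w.
  have h : 1 - t / 2 <= expR (- (t / 2)) by exact: expR_ge1Dx.
  have -> : w = expR (- (t / 2)) ^+ 2.
    by rewrite -expRM_natl; congr expR; field.
  apply: lerXn2r => //; rewrite nnegrE ?expR_ge0//; lra.
have e2 : expR (- t ^+ 2) <= (1 + t ^+ 2)^-1.
  rewrite expRN lef_pV2 ?posrE ?expR_gt0//; first exact: expR_ge1Dx.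
  by rewrite ltr_wpDr// sqr_ge0.
have e3 : (1 + t ^+ 2)^-1 <= 2 * w - w ^+ 2.
  have p0 : 0 < 1 + t ^+ 2 by rewrite ltr_wpDr// sqr_ge0.
  rewrite -[leLHS]mul1r ler_pdivrMr//.
  have y2 : (1 - w) ^+ 2 <= (t - t ^+ 2 / 4) ^+ 2.
    apply: lerXn2r => //; rewrite ?nnegrE; [lra|nra|].
    by move: wlb; rewrite !expr2; lra.
  have : (t - t ^+ 2 / 4) ^+ 2 * (1 + t ^+ 2) <= t ^+ 2.
    have -> : (t - t ^+ 2 / 4) ^+ 2 * (1 + t ^+ 2) =
       t ^+ 2 * (1 - t * (1 / 2 - 17 / 16 * t + t ^+ 2 / 2 - t ^+ 3 / 16)) by field.
    rewrite mulrBr mulr1 gerBl !mulr_ge0 ?sqr_ge0//.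
    have h1 : 0 <= t ^+ 2 * (2^-1 - t) by rewrite mulr_ge0 ?sqr_ge0//; lra.
    have h2 := sqr_ge0 (t - 2^-1).
    by lra.
  have := ler_wpM2r (ltW p0) y2.
  move: ((t - t ^+ 2 / 4) ^+ 2) => v; nra.
have -> : expR (t - t ^+ 2) = w^-1 * expR (- t ^+ 2) by rewrite expRD /w -expRN opprK.
have -> : 2 - w = w^-1 * (2 * w - w ^+ 2) by field; rewrite gt_eqF.
by rewrite ler_wpM2l ?invr_ge0 ?(ltW w0)// (le_trans e2).
Qed.

(* The exponent is optimal at [l = 1 + 2 ln (a / b)], as long as this is
   nonnegative; otherwise [l = 0] is good enough. *)
Lemma talagrand_exponent (a b : R) : 0 <= a <= b -> 0 < b ->
  exists2 l : R, 0 <= l <= 1 & (0 < l -> 0 < a) /\ forall x y,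
    b * expR ((1 - l) ^+ 2 / 4 + (l * x + (1 - l) * y)) <=
    (2 - a / b) * (l * (a * expR x) + (1 - l) * (b * expR y)).
Proof.
move=> /andP[a0 ab] b0.
have r1 : a / b <= 1 by rewrite ler_pdivrMr// mul1r.
have [rs|rs] := leP (a / b) (expR (- 2^-1)).
  exists 0; first by rewrite lexx ler01.
  split=> [|x y]; first by rewrite ltxx.
  rewrite subr0 !mul0r !add0r !mul1r expRD mulrCA.
  apply: ler_wpM2r; first by rewrite mulr_ge0 ?expR_ge0// ltW.
  (* The value [l = 0] corresponds to the endpoint [t = 1/2]; smaller ratios [a / b] only increase
     [2 - a / b]. *)
  have h : expR (2^-1 - 2^-1 ^+ 2) <= 2 - expR (- 2^-1) :> R.
    by apply: expR_sub_sqr_le; rewrite invr_ge0 ler0n lexx.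
  have -> : 1 ^+ 2 / 4 = 2^-1 - 2^-1 ^+ 2 :> R by field.
  by apply: le_trans h _; rewrite lerD2l lerN2.
have r0 : 0 < a / b by exact: lt_trans (expR_gt0 _) rs.
have a_gt0 : 0 < a by move: r0; rewrite pmulr_lgt0// invr_gt0.
pose t := - ln (a / b).
have et : expR (- t) = a / b by rewrite opprK lnK.
have t0 : 0 <= t by rewrite oppr_ge0 ln_le0.
have th : t <= 2^-1 by rewrite lerNl -ler_expR lnK// ltW.
exists (1 - 2 * t); first by apply/andP; split; lra.
split=> // x y; set l := 1 - 2 * t.
have l01 : 0 <= l <= 1 by rewrite /l; apply/andP; split; lra.
have -> : (1 - l) ^+ 2 / 4 + (l * x + (1 - l) * y) =
    (t - t ^+ 2) + (l * (x - t) + (1 - l) * y) by rewrite /l; field.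
rewrite expRD mulrCA -et; apply: ler_pM; rewrite ?expR_ge0//.
- by rewrite mulr_ge0 ?expR_ge0// ltW.
- by apply: expR_sub_sqr_le; rewrite t0.
have -> : a = b * expR (- t) by rewrite et mulrC divfK// gt_eqF.
have -> : l * (b * expR (- t) * expR x) + (1 - l) * (b * expR y) =
    b * (l * expR (x - t) + (1 - l) * expR y) by rewrite expRD; ring.
by by apply: ler_wpM2l; [exact: ltW|exact: expR_convex_comb].
Qed.

End talagrand_scalar.

Section talagrand_slots.
Context {R : realType} {I : finType}.
Implicit Types (st : seq (I * R)) (A : set {ffun I -> nat}).

(** Let [a] and [b] be the probabilities of the section [A1] and of the union [B]. An empty slot
    contributes a moment of at most [1 / b], an occupied one at most [(2 - a / b) / b], and [A] has
    probability at most [u * b] with [u = 1 - p + p * (a / b)]. The product is at most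
    [u * (2 - u)], hence at most 1. *)
Lemma talagrand_slots_exp st A : slots_ok st -> A !=set0 ->
  exists2 q : seq bool -> R,
    (forall S, 0 <= q S) /\ (forall S, sqdist_le A (slots_count st S) (q S)) &
    slots_prob st A * slots_mean st (fun S => expR (q S / 4)) <= 1.
Proof.
elim: st A => [|[i p] st IH] A.
  move=> _ [nu0 Anu0]; have [A0|nA0] := pselect (A [ffun=> 0%N]).
    exists (fun=> 0); last first.
      by rewrite /slots_prob/= mem_set// mul0r expR0 mulr1.
    split=> // S alpha z _ z0 zA; suff -> : z = 0 by rewrite expr0n mul0r.
    apply: le_anti; rewrite z0 andbT; apply: le_trans (zA _ A0) _.
    by rewrite /cost /= big1// => j _; rewrite !ffunE mulr0.
  exists (fun=> 0); last first.
    by rewrite /slots_prob/= memNset// mul0r ler01.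
  split=> // S alpha z _ z0 zA; suff -> : z = 0 by rewrite expr0n mul0r.
  apply: le_anti; rewrite z0 andbT; apply: le_trans (zA _ Anu0) _.
  by rewrite /cost /= big1// => j _; rewrite !ffunE sub0n mulr0.
move=> ok_cons [nu0 Anu0].
have /andP[/andP[p0 p1] ok] : (0 <= p <= 1) && slots_ok st := ok_cons.
set A1 := [set nu | A (incr i nu)]; set B := A `|` A1.
have B0 : B !=set0 by exists nu0; left.
have [qB [qB0 dB] EB] := IH B ok B0.
set a := slots_prob st A1; set b := slots_prob st B.
have a0 : 0 <= a by exact: slots_prob_ge0.
have ab : a <= b by apply: le_slots_prob => // nu ?; right.
have Ab : slots_prob st A <= b by apply: le_slots_prob => // nu ?; left.
have probE : slots_prob ((i, p) :: st) A = (1 - p) * slots_prob st A + p * a by [].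
have p1' : 0 <= 1 - p by rewrite subr_ge0.
have cntE S : slots_count ((i, p) :: st) S = if S is true :: S' then incr i (slots_count st S')
   else slots_count st (behead S).
  by case: S => [|[] S] //=; case: (st) => [|[]].
have [b_gt0|b_le0] := ltP 0 b; last first.
  (* Here [A] has probability 0, so any finite [q] will do; interpolation with [l = 0] provides
     one. *)
  have [l01 [] l0 h] : 0 <= (0 : R) <= 1 /\ True /\ True by rewrite lexx ler01.
  pose q S := if S is true :: S' then 1 + qB S' else qB (behead S).
  exists q.
    split=> [[|[] S]//=|S]; first by rewrite addr_ge0.
    rewrite cntE; case: S => [|[] S] /=; try by apply: (@sqdist_le_incr _ _ _ i).
    have := @sqdist_le_convex R I A i (slots_count st S) (qB S) 0 0 (qB0 S) l01.
    by rewrite subr0 expr1n !mul0r addr0 mul1r ltxx; apply.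
  rewrite probE (_ : _ + _ = 0) ?mul0r ?ler01//.
  have -> : a = 0 by apply: le_anti; rewrite a0 andbT (le_trans ab).
  have -> : slots_prob st A = 0.
    by apply: le_anti; rewrite slots_prob_ge0// andbT (le_trans Ab).
  by rewrite !mulr0 addr0.
have [l l01 [la lE]] : exists2 l : R, 0 <= l <= 1 & (0 < l -> 0 < a) /\ forall x y,
    b * expR ((1 - l) ^+ 2 / 4 + (l * x + (1 - l) * y)) <=
    (2 - a / b) * (l * (a * expR x) + (1 - l) * (b * expR y)).
  by apply: talagrand_exponent => //; rewrite a0.
have [q1 [q10 d1] E1] : exists2 q : seq bool -> R,
    (forall S, 0 <= q S) /\
    (0 < l -> forall S, sqdist_le A1 (slots_count st S) (q S)) &
    0 < l -> a * slots_mean st (fun S => expR (q S / 4)) <= 1.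
  (* For [l = 0] the section may be empty, and a dummy [q1] of weight 0 takes its place. *)
  have [l_gt0|_] := ltP 0 l; last by exists (fun=> 0).
  have [|q [? ?] ?] := IH A1 ok; last by exists q.
  have [A10|/set0P//] := eqVneq A1 set0; move: (la l_gt0).
  by rewrite /a A10 slots_prob_set0 ltxx.
pose q S := if S is true :: S' then (1 - l) ^+ 2 + l * q1 S' + (1 - l) * qB S'
  else qB (behead S).
exists q.
  split=> [[|[] S]//=|S].
    have /andP[? ?] := l01.
    by rewrite !addr_ge0 ?sqr_ge0// mulr_ge0// subr_ge0.
  rewrite cntE; case: S => [|[] S] /=; try by apply: (@sqdist_le_incr _ _ _ i).
  by apply: (sqdist_le_convex (qB0 S) l01) => // l0; split; [exact: q10|exact: d1].
rewrite probE [slots_mean _ _]/=.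
set X := slots_mean st _; set Y := slots_mean st _.
have X0 : 0 <= X by apply: slots_mean_ge0 => // S; exact: expR_ge0.
have Y0 : 0 <= Y by apply: slots_mean_ge0 => // S; exact: expR_ge0.
have r0 : 0 <= a / b by rewrite divr_ge0// ltW.
have r1 : a / b <= 1 by rewrite ler_pdivrMr// mul1r.
have bY : b * Y <= 2 - a / b.
  rewrite /Y -slots_meanZ.
  pose F S := (2 - a / b) * (l * (a * expR (q1 S / 4)) + (1 - l) * (b * expR (qB S / 4))).
  apply: (@le_trans _ _ (slots_mean st F)).
    apply: slots_mean_le => // S; apply: le_trans (lE _ _); rewrite le_eqVlt.
    by apply/orP; left; apply/eqP; congr (_ * expR _); field.
  rewrite slots_meanZ slots_meanD !slots_meanZ -[leRHS]mulr1.
  apply: ler_wpM2l; first by lra.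
  have /andP[l0 l1] := l01.
  rewrite [leRHS](_ : 1 = l * 1 + (1 - l) * 1); last by ring.
  apply: lerD; last by apply: ler_wpM2l => //; rewrite subr_ge0.
  move: l0; rewrite le_eqVlt => /orP[/eqP <-|l0]; first by rewrite !mul0r.
  by apply: ler_wpM2l; [exact: ltW|exact: E1].
have bX : b * X <= 1 by [].
set u := (1 - p) + p * (a / b).
have u0 : 0 <= u by rewrite addr_ge0// mulr_ge0.
have hA : (1 - p) * slots_prob st A + p * a <= u * b.
  have -> : u * b = (1 - p) * b + p * a by rewrite /u; field; rewrite gt_eqF.
  by rewrite lerD2r; exact: ler_wpM2l.
apply: (@le_trans _ _ (u * b * ((1 - p) * X + p * Y))).
  by apply: ler_wpM2r => //; rewrite addr_ge0// mulr_ge0.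
have -> : u * b * ((1 - p) * X + p * Y) = u * ((1 - p) * (b * X) + p * (b * Y)) by ring.
apply: (@le_trans _ _ (u * ((1 - p) * 1 + p * (2 - a / b)))).
  by apply: ler_wpM2l => //; apply: lerD; exact: ler_wpM2l.
have -> : (1 - p) * 1 + p * (2 - a / b) = 2 - u by rewrite /u; ring.
have := sqr_ge0 (u - 1); lra.
Qed.

Definition separated (s : R) (F1 F2 : set {ffun I -> nat}) : Prop :=
  forall xi, F2 xi -> exists2 alpha : I -> R, (forall i, 0 <= alpha i) &
    sqnorm alpha xi <= 1 /\ forall nu, F1 nu -> s < cost alpha xi nu.

(** Markov's inequality: on [F2] the separating [alpha] forces [q S >= s^2]. *)
Lemma talagrand_slots st s F1 F2 : slots_ok st -> 0 <= s -> separated s F1 F2 ->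
  slots_prob st F1 * slots_prob st F2 <= expR (- (s ^+ 2 / 4)).
Proof.
move=> ok s0 sep.
have [->|/set0P F1n0] := eqVneq F1 set0.
  by rewrite slots_prob_set0 mul0r expR_ge0.
have [q [q0 dq] Eq] := talagrand_slots_exp ok F1n0.
have h : expR (s ^+ 2 / 4) * slots_prob st F2 <=
    slots_mean st (fun S => expR (q S / 4)).
  rewrite -slots_meanZ; apply: slots_mean_le => // S.
  have [|_] := boolP (_ \in F2); last by rewrite mulr0 expR_ge0.
  rewrite inE mulr1 => /sep [alpha a0 [a1 sa]].
  rewrite ler_expR ler_pM2r ?invr_gt0//.
  have := dq S _ _ a0 s0 (fun nu H => ltW (sa nu H)).
  by move=> /le_trans; apply; rewrite ler_piMr.
rewrite expRN -[leRHS]mul1r ler_pdivlMr ?expR_gt0// -mulrA [_ * expR _]mulrC.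
apply: le_trans Eq; apply: ler_wpM2l => //; exact: slots_prob_ge0.
Qed.

End talagrand_slots.

(** * From Bernoulli slots to Poisson counts *)

Section poisson_limit.
Context {R : realType} {I : finType}.
Implicit Types (st : seq (I * R)) (nu kappa : {ffun I -> nat}).

Definition binom_weight n (p : R) k : R :=
  'C(n, k)%:R * p ^+ k * (1 - p) ^+ (n - k).

Definition blocks n (p : I -> R) (s : seq I) : seq (I * R) :=
  flatten [seq nseq n (i, p i) | i <- s].

Lemma iter_incr k i nu j : iter k (incr i) nu j = ((i == j) * k + nu j)%N.
Proof.
elim: k => [|k IH] /=; first by rewrite muln0.
by rewrite ffunE IH mulnS addnA.
Qed.

Lemma binom_weight_ge0 n p k : 0 <= p <= 1 -> 0 <= binom_weight n p k.
Proof.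
by move=> /andP[p0 p1]; rewrite !mulr_ge0 ?exprn_ge0// subr_ge0.
Qed.

(** Only the event that exactly [k] of the [n] slots fire is kept, whence an inequality for
    nonnegative [F]. Lower bounds are enough, since slot probabilities stand on the smaller side of
    [talagrand_slots]. The induction is Pascal's rule. *)
Lemma slots_mean_block n i (p : R) st (F : {ffun I -> nat} -> R) k :
  slots_ok st -> 0 <= p <= 1 -> (forall nu, 0 <= F nu) ->
  binom_weight n p k *
    slots_mean st (fun S => F (iter k (incr i) (slots_count st S))) <=
  slots_mean (nseq n (i, p) ++ st)
    (fun S => F (slots_count (nseq n (i, p) ++ st) S)).
Proof.
move=> ok p01; have /andP[p0 p1] := p01.
have q0 : 0 <= 1 - p by rewrite subr_ge0.
have ok' m : slots_ok (nseq m (i, p) ++ st).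
  by rewrite /slots_ok all_cat all_nseq /= p01 orbT.
elim: n F k => [|n IH] F k F0.
  case: k => [|k]; rewrite /binom_weight.
    by rewrite bin0 !expr0 !mulr1 mul1r.
  by rewrite bin0n !mul0r slots_mean_ge0.
set X := fun k : nat => slots_mean st
  (fun S => F (iter k (incr i) (slots_count st S))).
have X0 k' : 0 <= X k' by exact: slots_mean_ge0.
rewrite -/(X k) /= -/(_ ++ _); set st' := nseq n (i, p) ++ st.
case: k => [|k].
  apply: (@le_trans _ _ ((1 - p) * slots_mean st' (fun S => F (slots_count st' S)))).
    apply: le_trans (ler_wpM2l q0 (IH F 0%N F0)).
    by rewrite mulrA /binom_weight !bin0 !subn0 exprS !expr0 !mul1r ?mulr1.
  rewrite lerDl mulr_ge0//; apply: slots_mean_ge0; first exact: ok'.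
  by move=> S; exact: F0.
apply: (@le_trans _ _ ((1 - p) * (binom_weight n p k.+1 * X k.+1) +
    p * (binom_weight n p k * X k.+1))).
  rewrite !mulrA -mulrDl; apply: ler_wpM2r => //.
  rewrite /binom_weight binS natrD subSS exprS.
  have [nk|nk] := leqP n k.
    by rewrite bin_small// le_eqVlt; apply/orP; left; apply/eqP; ring.
  have -> : (n - k = (n - k.+1).+1)%N by rewrite subnSK.
  by rewrite le_eqVlt; apply/orP; left; apply/eqP; rewrite [_ ^+ _.+1]exprS; ring.
apply: lerD; apply: ler_wpM2l => //; first exact: IH.
by apply: (IH (fun nu => F (incr i nu))) => nu; exact: F0.
Qed.

Lemma slots_ok_blocks n p s : (forall i, 0 <= p i <= 1) ->
  slots_ok (blocks n p s).
Proof.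
move=> p01; elim: s => [//|i s IH].
by rewrite /slots_ok /= all_cat all_nseq /= p01 orbT.
Qed.

Lemma slots_prob_blocks n p s kappa : (forall i, 0 <= p i <= 1) -> uniq s ->
  (forall j, j \notin s -> kappa j = 0%N) ->
  \prod_(i <- s) binom_weight n (p i) (kappa i) <=
  slots_prob (blocks n p s) [set kappa].
Proof.
move=> p01; elim: s kappa => [|i s IH] kappa.
  move=> _ k0; rewrite big_nil /slots_prob/= mem_set//.
  by apply/ffunP => j; rewrite ffunE k0.
move=> /= /andP[si us] k0; rewrite big_cons.
pose kappa' : {ffun I -> nat} := [ffun j => if j == i then 0%N else kappa j].
have ok := slots_ok_blocks n s p01.
pose F nu : R := (nu \in [set kappa])%:R.
have F0 nu : 0 <= F nu by rewrite ler0n.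
apply: le_trans (slots_mean_block n i (kappa i) ok (p01 i) F0).
apply: ler_wpM2l; first exact: binom_weight_ge0.
have -> : \prod_(j <- s) binom_weight n (p j) (kappa j) =
    \prod_(j <- s) binom_weight n (p j) (kappa' j).
  rewrite big_seq [RHS]big_seq; apply: eq_bigr => j js.
  by rewrite ffunE; case: eqP => // ji; rewrite -ji js in si.
apply: le_trans (IH kappa' us _) _.
  move=> j js; rewrite ffunE; case: eqP => // /eqP ji.
  by apply: k0; rewrite inE negb_or ji.
apply: slots_mean_le => // S; rewrite ler_nat.
case: (boolP (_ \in [set kappa'])) => //; rewrite inE /= => ->.
rewrite mem_set//=; apply/ffunP => j; rewrite iter_incr ffunE eq_sym.
by case: eqP => [->|_]; rewrite ?mul1n ?addn0 ?mul0n.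
Qed.

Definition poisson_weight (l : R) k : R := l ^+ k / k`!%:R * expR (- l).

(** An explicit lower bound with the Poisson weight as its limit: the falling factorial is at least
    [(n - k)^k], and [1 - x >= expR (- (x / (1 - x)))]. *)
Lemma binom_weight_lb n (l : R) k : (k <= n)%N -> 0 <= l -> l < n%:R ->
  l ^+ k / k`!%:R * ((1 - k%:R / n%:R) ^+ k * expR (- (l / (1 - l / n%:R)))) <=
  binom_weight n (l / n%:R) k.
Proof.
move=> kn l0 ln; have n0 : 0 < n%:R :> R by exact: le_lt_trans ln.
set x := l / n%:R; have x0 : 0 <= x by rewrite divr_ge0// ltW.
have x1 : x < 1 by rewrite ltr_pdivrMr// mul1r.
have q0 : 0 < 1 - x by rewrite subr_gt0.
have e1 : expR (- (l / (1 - x))) <= (1 - x) ^+ n.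
  have -> : - (l / (1 - x)) = n%:R * (- (x / (1 - x))).
    by rewrite mulrN mulrA [n%:R * x]mulrC divfK ?gt_eqF.
  rewrite expRM_natl; apply: lerXn2r; rewrite ?nnegrE ?expR_ge0 ?(ltW q0)//.
  rewrite expRN -[leRHS]invrK lef_pV2 ?posrE ?expR_gt0 ?invr_gt0//.
  rewrite [leLHS](_ : _ = 1 + x / (1 - x)); last by field; rewrite gt_eqF.
  exact: expR_ge1Dx.
have e2 : (1 - x) ^+ n <= (1 - x) ^+ (n - k).
  by apply: ler_wiXn2l; rewrite ?leq_subr ?(ltW q0) ?gerBl.
have e3 : l ^+ k / k`!%:R * (1 - k%:R / n%:R) ^+ k <= 'C(n, k)%:R * x ^+ k.
  have -> : 1 - k%:R / n%:R = (n - k)%:R / n%:R :> R.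
    by rewrite natrB// mulrBl divff// gt_eqF.
  rewrite /x !expr_div_n.
  have -> : l ^+ k / k`!%:R * ((n - k)%:R ^+ k / n%:R ^+ k) =
    ((n - k)%:R ^+ k / k`!%:R) * (l ^+ k / n%:R ^+ k) :> R by ring.
  apply: ler_wpM2r; first by rewrite divr_ge0// exprn_ge0.
  rewrite ler_pdivrMr ?ltr0n ?fact_gt0// -natrX -natrM ler_nat bin_ffact.
  have ffact_lb j : (j <= k -> (n - k) ^ j <= n ^_ j)%N.
    elim: j => [//|j IHj jk]; rewrite expnSr ffactnSr leq_mul//.
      exact/IHj/ltnW.
    by rewrite leq_sub2l// ltnW.
  exact: ffact_lb.
rewrite mulrA; apply: ler_pM; rewrite ?expR_ge0//; last exact: le_trans e2.
rewrite mulr_ge0 ?divr_ge0 ?exprn_ge0// subr_ge0 ler_pdivrMr// mul1r.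
by rewrite ler_nat.
Qed.

Lemma cvg_binom_weight_lb (l : R) k : 
  (fun n => l ^+ k / k`!%:R * ((1 - k%:R / n.+1%:R) ^+ k *
    expR (- (l / (1 - l / n.+1%:R))))) @ \oo --> poisson_weight l k.
Proof.
have h0 : (fun n : nat => n.+1%:R^-1 : R) @ \oo --> (0 : R) by exact: cvg_harmonic.
have c1 (a : R) : (fun n : nat => 1 - a / n.+1%:R) @ \oo --> (1 : R).
  rewrite -[X in _ --> X]subr0 -(mulr0 a); apply: cvgB; first exact: cvg_cst.
  by apply: cvgM => //; exact: cvg_cst.
apply: cvgM; first exact: cvg_cst.
rewrite -[X in _ --> X]mul1r; apply: cvgM.
  rewrite -[X in _ --> X](expr1n _ k).
  exact: (@cvg_comp _ _ _ _ (fun x => x ^+ k) _ _ _ (c1 k%:R) (@exprn_continuous _ _ _)).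
apply: (@cvg_comp _ _ _ _ expR _ _ _ _ (@continuous_expR _ _)).
apply: cvgN; rewrite -[X in _ --> X](divr1 l); apply: cvgM; first exact: cvg_cst.
by apply: cvgV => //; exact: oner_neq0.
Qed.

Lemma slots_prob_finite st (F : seq {ffun I -> nat}) : uniq F ->
  slots_prob st [set` F] = \sum_(kappa <- F) slots_prob st [set kappa].
Proof.
elim: F => [|kappa F IH] /=.
  by rewrite big_nil (_ : [set` [::]] = set0) ?slots_prob_set0//; apply/seteqP; split.
move=> /andP[kF uF]; rewrite big_cons -IH// /slots_prob -slots_meanD.
apply: slots_mean_eq => S; rewrite -natrD; congr (_%:R).
have mE (G : seq {ffun I -> nat}) x : (x \in [set` G]) = (x \in G).
  by apply/idP/idP; rewrite inE.
rewrite !mE inE (_ : (_ \in [set kappa]) = (slots_count st S == kappa)); last first.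
  by apply/idP/eqP; rewrite inE.
by case: eqP => [->|]; rewrite ?(negPf kF).
Qed.

Lemma talagrand_poisson (lam : I -> R) (s : R) (F1 F2 : seq {ffun I -> nat}) :
  (forall i, 0 <= lam i) -> uniq F1 -> uniq F2 -> 0 <= s ->
  separated s [set` F1] [set` F2] ->
  (\sum_(kappa <- F1) \prod_i poisson_weight (lam i) (kappa i)) *
  (\sum_(kappa <- F2) \prod_i poisson_weight (lam i) (kappa i)) <=
  expR (- (s ^+ 2 / 4)).
Proof.
move=> lam0 uF1 uF2 s0 sep.
pose w n kappa : R := \prod_i (lam i ^+ kappa i / (kappa i)`!%:R *
  ((1 - (kappa i)%:R / n.+1%:R) ^+ kappa i * expR (- (lam i / (1 - lam i / n.+1%:R))))).
have w_cvg kappa : w ^~ kappa @ \oo --> \prod_i poisson_weight (lam i) (kappa i).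
  by apply: (cvg_big (@mul_continuous R)) => i _; exact: cvg_binom_weight_lb.
have sum_cvg F : (fun n => \sum_(kappa <- F) w n kappa) @ \oo -->
    \sum_(kappa <- F) \prod_i poisson_weight (lam i) (kappa i).
  by apply: (cvg_big (@add_continuous R)) => kappa _; exact: w_cvg.
(* From [N] on, all slot probabilities are at most 1 and all counts occurring in the two finite
   lists fit into the blocks. *)
pose N := (\sum_i Num.bound (lam i) + \sum_(kappa <- F1 ++ F2) \sum_i kappa i)%N.
apply: (cvgr_to_le (cvgM (sum_cvg F1) (sum_cvg F2))).
exists N => // n /= Nn; set p := fun i => lam i / n.+1%:R.
have lam_lt i : lam i < n.+1%:R.
  apply: lt_trans (archi_boundP (lam0 i)) _; rewrite ltr_nat ltnS.
  apply: leq_trans Nn; rewrite (leq_trans _ (leq_addr _ _))//.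
  by rewrite (bigD1 i)//= leq_addr.
have p01 i : 0 <= p i <= 1.
  by rewrite /p divr_ge0//= ler_pdivrMr// mul1r ltW.
have kappa_le i kappa : kappa \in F1 ++ F2 -> (kappa i <= n.+1)%N.
  move=> kF; apply/leqW/(leq_trans _ Nn)/(leq_trans _ (leq_addl _ _)).
  by rewrite (big_rem kappa)//= (bigD1 i)//= -addnA leq_addr.
have w_ge0 kappa : kappa \in F1 ++ F2 -> 0 <= w n kappa.
  move=> kF; apply: prodr_ge0 => i _.
  rewrite !mulr_ge0 ?expR_ge0 ?exprn_ge0 ?invr_ge0// subr_ge0.
  by rewrite ler_pdivrMr// mul1r ler_nat kappa_le.
have w_le kappa : kappa \in F1 ++ F2 ->
    w n kappa <= slots_prob (blocks n.+1 p (enum I)) [set kappa].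
  move=> kF; apply: le_trans (slots_prob_blocks n.+1 p01 (enum_uniq I) _).
    rewrite [leRHS]big_enum; apply: ler_prod => i _; apply/andP; split.
      rewrite !mulr_ge0 ?expR_ge0 ?exprn_ge0 ?invr_ge0// subr_ge0.
      by rewrite ler_pdivrMr// mul1r ler_nat kappa_le.
    by apply: binom_weight_lb => //; exact: kappa_le.
  by move=> j; rewrite mem_enum.
have ok := slots_ok_blocks n.+1 (enum I) p01.
have sum_le F : uniq F -> {subset F <= F1 ++ F2} ->
    0 <= \sum_(kappa <- F) w n kappa <=
    slots_prob (blocks n.+1 p (enum I)) [set` F].
  move=> uF FF; rewrite slots_prob_finite//; apply/andP; split.
    by rewrite big_seq; apply: sumr_ge0 => kappa /FF; exact: w_ge0.
  rewrite big_seq [leRHS]big_seq; apply: ler_sum => kappa /FF; exact: w_le.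
have /andP[? ?] : 0 <= \sum_(kappa <- F1) w n kappa <=
    slots_prob (blocks n.+1 p (enum I)) [set` F1].
  by apply: sum_le => // kappa kF; rewrite mem_cat kF.
have /andP[? ?] : 0 <= \sum_(kappa <- F2) w n kappa <=
    slots_prob (blocks n.+1 p (enum I)) [set` F2].
  by apply: sum_le => // kappa kF; rewrite mem_cat kF orbT.
by apply: le_trans (talagrand_slots ok s0 sep); exact: ler_pM.
Qed.

End poisson_limit.

(** * Poisson counts on disjoint Borel cells *)

Section cell_counts.
Context {E : topologicalType} {I : finType} (B : I -> set E).

Definition cell_counts (xi : fcmeasure E) : {ffun I -> nat} :=
  [ffun i => fcmass xi (B i)].

Lemma measurable_fcmass_event (C : set E) (U : set nat) : borel C ->
  measurable [set xi : fcmeasure E | U (fcmass xi C)].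
Proof. by move=> bC; apply: sub_sigma_algebra; exists C, U. Qed.

Hypothesis borelB : forall i, borel (B i).

Lemma measurable_cell_counts (F : set {ffun I -> nat}) :
  measurable [set xi | F (cell_counts xi)].
Proof.
have -> : [set xi | F (cell_counts xi)] =
    \bigcup_(kappa in F) \bigcap_(i in [set: I]) [set xi | fcmass xi (B i) = kappa i].
  apply/seteqP; split=> [xi /= Fxi|xi [kappa Fk] /= h].
    by exists (cell_counts xi) => // i _ /=; rewrite ffunE.
  by rewrite (_ : cell_counts xi = kappa)//; apply/ffunP => i; rewrite ffunE h.
rewrite bigcup_mkcond; apply: countable_bigcupT_measurable => [//|kappa].
case: ifP => // _; apply: fin_bigcap_measurable; first exact: finite_finset.
by move=> i _; exact: (measurable_fcmass_event [set kappa i]).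
Qed.

End cell_counts.

Section poisson_cells.
Context {E : topologicalType} {R : realType} {d : measure_display}
  {Omega : measurableType d} (P : probability Omega R)
  (eta : {RV P >-> fcmeasure E}) (eta_poisson : finite_poisson_process eta)
  {I : finType} (B : I -> set E) (borelB : forall i, borel (B i))
  (disjB : trivIset [set: I] B).

Let X (F : set {ffun I -> nat}) : set Omega :=
  [set w | F (cell_counts B (eta w))].

Let lam (i : I) : R := fine (intensity eta (B i)).

Let mX F : measurable (X F).
Proof.
have := @measurable_funPT _ _ _ _ eta measurableT _ (measurable_cell_counts borelB F).
by rewrite setTI.
Qed.

Let lam_ge0 i : 0 <= lam i.
Proof. by apply: fine_ge0; apply: expectation_ge0 => w; rewrite ler0n. Qed.

Let prob_count i k :
  P [set w | fcmass (eta w) (B i) = k] = (poisson_weight (lam i) k)%:E.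
Proof.
have [_ pois _] := eta_poisson.
rewrite (pois (B i) [set k] (borelB i)) -/(lam i) /poisson_prob /poisson_weight.
have [l0|] := ltP 0 (lam i).
  by rewrite esum_set1 ?lee_fin ?poisson_pmf_ge0// /poisson_pmf l0.
move=> l0; have -> : lam i = 0 by apply: le_anti; rewrite l0 lam_ge0.
rewrite oppr0 expR0 mulr1 diracE expr0n; case: k => [|k].
  by rewrite mem_set// fact0 divr1.
by rewrite memNset// mul0r.
Qed.

Let prob_counts kappa :
  P (X [set kappa]) = (\prod_i poisson_weight (lam i) (kappa i))%:E.
Proof.
have [_ _ indep] := eta_poisson.
have dB : trivIset [set: 'I_#|I|] (fun i => B (enum_val i)).
  move=> i j _ _ ij; apply/enum_val_inj; exact: disjB.
have := indep _ _ (fun i => borelB _) dB (fun i => [set kappa (enum_val i)]).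
have -> : [set w | forall i : 'I_#|I|,
    [set kappa (enum_val i)] (fcmass (eta w) (B (enum_val i)))] = X [set kappa].
  apply/seteqP; split=> w /= h.
    by apply/ffunP => i; rewrite ffunE -(enum_rankK i) h.
  by move=> i; rewrite -h ffunE.
move=> ->; rewrite -prodEFin [RHS](reindex (@enum_val I I))/=; last first.
  by exists enum_rank => i _; rewrite ?enum_valK ?enum_rankK.
by apply: eq_bigr => i _; exact: prob_count.
Qed.

Let prob_finite (F : seq {ffun I -> nat}) : uniq F ->
  P (X [set` F]) = (\sum_(kappa <- F) \prod_i poisson_weight (lam i) (kappa i))%:E.
Proof.
elim: F => [_|kappa F IH /= /andP[kF uF]].
  by rewrite big_nil (_ : X _ = set0) ?measure0//; apply/seteqP; split.
have -> : X [set` kappa :: F] = X [set kappa] `|` X [set` F].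
  apply/seteqP; split=> w; rewrite /X /= inE.
    by move=> /orP[/eqP|]; [left|right].
  by move=> [->|->]; rewrite ?eqxx ?orbT.
rewrite measureU//; last first.
  by apply/seteqP; split => // w []; rewrite /X /= => ->; rewrite (negPf kF).
by rewrite big_cons EFinD; congr (_ + _)%E; [exact: prob_counts|exact: IH].
Qed.

(** There are countably many count vectors, so [F1] and [F2] are exhausted by finite lists, which
    stay separated; continuity from below does the rest. *)
Lemma talagrand_cells (s : R) (F1 F2 : set {ffun I -> nat}) :
  0 <= s -> separated s F1 F2 ->
  (P [set w | F1 (cell_counts B (eta w))] *
   P [set w | F2 (cell_counts B (eta w))] <= (expR (- (s ^+ 2 / 4)))%:E)%E.
Proof.
move=> s0 sep; rewrite -/(X F1) -/(X F2).
pose Fs (F : set {ffun I -> nat}) n :=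
  [seq kappa <- pmap pickle_inv (iota 0 n) | kappa \in F].
have Fs_uniq F n : uniq (Fs F n).
  by apply: filter_uniq; apply: (pmap_uniq (@pickle_invK _)); exact: iota_uniq.
have FsE F n (kappa : {ffun I -> nat}) : kappa \in Fs F n = (kappa \in F) && (choice.pickle kappa < n)%N.
  rewrite mem_filter mem_pmap; congr (_ && _); apply/mapP/idP => [[k]|kn].
    rewrite mem_iota add0n /= => kn e.
    by have := @pickle_invK {ffun I -> nat} k; rewrite -e /= => ->.
  by exists (choice.pickle kappa); rewrite ?mem_iota// pickleK_inv.
have cvgP F : (fun n => fine (P (X [set` Fs F n]))) @ \oo --> fine (P (X F)).
  have XF : X F = \bigcup_n X [set` Fs F n].
    apply/seteqP; split=> [w Fw|w [n _]].
      by exists (choice.pickle (cell_counts B (eta w))).+1 => //=; rewrite /X/= FsE ltnSn mem_set.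
    by rewrite /X /= FsE => /andP[]; rewrite inE.
  have /fine_cvgP[] : P (X [set` Fs F n]) @[n --> \oo] --> (fine (P (X F)))%:E; last by [].
  rewrite fineK ?fin_num_measure// XF; apply: nondecreasing_cvg_mu => //.
    exact: bigcup_measurable.
  move=> m n mn; apply/subsetPset => w; rewrite /X /= !FsE => /andP[-> /=].
  by move=> /leq_trans; apply.
rewrite -[P (X F1)]fineK ?fin_num_measure// -[P (X F2)]fineK ?fin_num_measure//.
rewrite -EFinM lee_fin.
apply: (cvgr_to_le (cvgM (cvgP F1) (cvgP F2))); apply: nearW => n /=.
rewrite !prob_finite// /fine; apply: talagrand_poisson => //.
move=> xi; rewrite /= FsE => /andP[/set_mem/sep[alpha a0 [a1 h]] _].
exists alpha => //; split=> // nu; rewrite /= FsE => /andP[/set_mem F1nu _].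
exact: h.
Qed.

End poisson_cells.

(** * Analytic sets and capacitability *)

Notation baire := (nat -> nat).

Section analytic_sets.
Implicit Types (g h : baire) (F S T : set baire) (phi psi : baire -> baire).

Definition agree (n : nat) g h := forall i, (i < n)%N -> g i = h i.

Definition baire_closed F := forall g, (forall n, exists2 h, F h & agree n g h) -> F g.

Definition baire_continuous phi :=
  forall g i, exists n, forall h, agree n g h -> phi h i = phi g i.

(** A closed domain, rather than the whole Baire space, includes the empty set and allows domains
    cut out by equations, as preimages and intersections require. *)
Definition analytic S := exists F phi,
  [/\ baire_closed F, baire_continuous phi & S = phi @` F].

(** Through the numbering of pairs, one point of the Baire space carries a whole sequence of
    points. *)
Definition slice (k : nat) g : baire := fun i => g (choice.pickle (k, i)).

Definition merge_slices (G : nat -> baire) : baire := fun n =>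
  if choice.unpickle n is Some (k, i) then G k i else 0%N.

Lemma slice_merge G k : slice k (merge_slices G) = G k.
Proof. by apply/funext => i; rewrite /slice /merge_slices choice.pickleK. Qed.

Lemma agreeW m n g h : (m <= n)%N -> agree n g h -> agree m g h.
Proof. by move=> mn gh i im; apply: gh; exact: leq_trans mn. Qed.

Lemma agree_trans n g1 g2 g3 : agree n g1 g2 -> agree n g2 g3 -> agree n g1 g3.
Proof. by move=> h12 h23 i i_n; rewrite h12// h23. Qed.

Lemma baire_continuous_agree phi g n : baire_continuous phi ->
  exists m, forall h, agree m g h -> agree n (phi g) (phi h).
Proof.
move=> cphi; elim: n => [|n [m hm]]; first by exists 0%N.
have [m' hm'] := cphi g n; exists (maxn m m') => h gh i.
rewrite ltnS leq_eqVlt => /orP[/eqP ->|i_n].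
  by rewrite hm'//; apply: agreeW gh; rewrite leq_maxr.
by apply: hm i_n; apply: agreeW gh; rewrite leq_maxl.
Qed.

Lemma baire_continuous_comp phi psi : baire_continuous phi ->
  baire_continuous psi -> baire_continuous (fun h => phi (psi h)).
Proof.
move=> cphi cpsi g i; have [n hn] := cphi (psi g) i.
have [m hm] := baire_continuous_agree g n cpsi.
by exists m => h /hm; exact: hn.
Qed.

Lemma baire_continuous_slice k : baire_continuous (slice k).
Proof.
move=> g i; exists (choice.pickle (k, i)).+1 => h gh.
by rewrite /slice gh.
Qed.

Lemma baire_continuous_id : baire_continuous id.
Proof. by move=> g i; exists i.+1 => h gh; rewrite gh. Qed.

Lemma baire_continuous_sum (I : Type) (r : seq I) (a : I -> nat)
    (f : I -> baire -> baire) : (forall i, baire_continuous (f i)) ->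
  baire_continuous (fun g n => \sum_(i <- r) a i * f i g n)%N.
Proof.
move=> cf g n; elim: r => [|i r [m hm]].
  by exists 0%N => h _; rewrite !big_nil.
have [m' hm'] := cf i g n; exists (maxn m m') => h gh.
rewrite !big_cons hm' ?hm//; apply: agreeW gh; first by rewrite leq_maxl.
by rewrite leq_maxr.
Qed.

Lemma baire_continuous_add phi psi : baire_continuous phi ->
  baire_continuous psi -> baire_continuous (fun g n => phi g n + psi g n)%N.
Proof.
move=> cphi cpsi g n; have [m hm] := cphi g n; have [m' hm'] := cpsi g n.
exists (maxn m m') => h gh; rewrite hm ?hm'//; apply: agreeW gh.
  by rewrite leq_maxr.
by rewrite leq_maxl.
Qed.

Lemma baire_closed_preimage phi F : baire_continuous phi -> baire_closed F ->
  baire_closed (phi @^-1` F).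
Proof.
move=> cphi cF g gF; apply: cF => n.
have [m hm] := baire_continuous_agree g n cphi.
by have [h Fh /hm] := gF m; exists (phi h).
Qed.

Lemma baire_closed_bigcap (I : Type) (D : set I) (F : I -> set baire) :
  (forall i, D i -> baire_closed (F i)) -> baire_closed (\bigcap_(i in D) F i).
Proof.
move=> cF g gF i Di; apply: cF => // n; have [h hF gh] := gF n.
by exists h => //; exact: hF.
Qed.

Lemma baire_closedI F S : baire_closed F -> baire_closed S -> baire_closed (F `&` S).
Proof.
move=> cF cS g gFS; split.
  by apply: cF => n; have [h [Fh _] gh] := gFS n; exists h.
by apply: cS => n; have [h [_ Sh] gh] := gFS n; exists h.
Qed.

Lemma baire_closed_eq phi psi : baire_continuous phi -> baire_continuous psi ->
  baire_closed [set h | phi h = psi h].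
Proof.
move=> cphi cpsi g gE; apply/funext => i.
have [m hm] := cphi g i; have [m' hm'] := cpsi g i.
have [h /= hE gh] := gE (maxn m m').
rewrite -(hm h); last by apply: agreeW gh; rewrite leq_maxl.
by rewrite hE hm'//; apply: agreeW gh; rewrite leq_maxr.
Qed.

Lemma baire_closed_finitary n F :
  (forall g h, agree n g h -> F h -> F g) -> baire_closed F.
Proof. by move=> Fn g /(_ n)[h Fh gh]; exact: Fn Fh. Qed.

Lemma analytic_closed F : baire_closed F -> analytic F.
Proof.
move=> cF; exists F, id; split => //; first exact: baire_continuous_id.
by rewrite image_id.
Qed.

Lemma analytic_image phi S : baire_continuous phi -> analytic S ->
  analytic (phi @` S).
Proof.
move=> cphi [F [psi [cF cpsi ->]]]; exists F, (fun h => phi (psi h)); split => //.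
  exact: baire_continuous_comp.
by rewrite image_comp.
Qed.

(** The preimage is the projection of the fibre product of [psi] and [phi], held in slices 0 and
    1. *)
Lemma analytic_preimage phi S : baire_continuous phi -> analytic S ->
  analytic (phi @^-1` S).
Proof.
move=> cphi [F [psi [cF cpsi ->]]].
exists (slice 0 @^-1` F `&` [set h | psi (slice 0 h) = phi (slice 1 h)]), (slice 1).
have s0 := @baire_continuous_slice 0; have s1 := @baire_continuous_slice 1.
split => //.
  apply: baire_closedI; first exact: baire_closed_preimage.
  by apply: baire_closed_eq; exact: baire_continuous_comp.
apply/seteqP; split=> [g [f Ff /= fg]|_ [h [Fh /= eh] <-]] /=.
  exists (merge_slices (fun k => if k is 0%N then f else g)); last by rewrite slice_merge.
  by split; rewrite /= ?slice_merge.
by exists (slice 0 h).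
Qed.

(** A countable fibre product: slice [n] witnesses membership in [S n], and all slices must have the
    same image. *)
Lemma analytic_bigcap (S : nat -> set baire) :
  (forall n, analytic (S n)) -> analytic (\bigcap_n S n).
Proof.
move=> /choice[F /choice[phi aS]].
have cF n : baire_closed (F n) by case: (aS n).
have cphi n : baire_continuous (phi n) by case: (aS n).
have SE n : S n = phi n @` F n by case: (aS n).
exists (\bigcap_n (slice n @^-1` F n `&`
  [set h | phi n (slice n h) = phi 0%N (slice 0 h)])), (fun h => phi 0%N (slice 0 h)).
have sl := baire_continuous_slice.
split => //.
- apply: baire_closed_bigcap => n _; apply: baire_closedI.
    exact: baire_closed_preimage.
  by apply: baire_closed_eq; exact: baire_continuous_comp.
- exact: baire_continuous_comp.
apply/seteqP; split=> [g Sg|_ [h Fh <-] n _]; last first.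
  by have [? /= <-] := Fh n I; rewrite SE; exists (slice n h).
have /choice[G GP] : forall n, exists f, F n f /\ phi n f = g.
  by move=> n; have := Sg n I; rewrite SE => -[f Ff fg]; exists f.
exists (merge_slices G); last by rewrite slice_merge; case: (GP 0%N).
move=> n _; split; rewrite /= !slice_merge; first by case: (GP n).
by rewrite (GP n).2 (GP 0%N).2.
Qed.

Lemma analyticI S T : analytic S -> analytic T -> analytic (S `&` T).
Proof.
move=> aS aT; rewrite -bigcap2E; apply: analytic_bigcap => n.
by rewrite /bigcap2; case: n => [//|[//|n]]; exact: analytic_closed.
Qed.

Lemma analytic0 : analytic set0.
Proof. by apply: analytic_closed => g /(_ 0%N)[]. Qed.

(** The number [slice 0 h 0] selects the set and [slice 1 h] is the argument. The selector is
    locally constant, so closedness and continuity are inherited from each piece. *)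
Lemma analytic_bigcup (S : nat -> set baire) :
  (forall n, analytic (S n)) -> analytic (\bigcup_n S n).
Proof.
move=> /choice[F /choice[phi aS]].
have cF n : baire_closed (F n) by case: (aS n).
have cphi n : baire_continuous (phi n) by case: (aS n).
have SE n : S n = phi n @` F n by case: (aS n).
have s0 := @baire_continuous_slice 0; have s1 := @baire_continuous_slice 1.
exists [set h | F (slice 0 h 0%N) (slice 1 h)], (fun h => phi (slice 0 h 0%N) (slice 1 h)).
split.
- move=> g gF /=; have [m hm] := s0 g 0%N; apply: cF => n.
  have [m' hm'] := baire_continuous_agree g n s1.
  have [h /= Fh gh] := gF (maxn m m'); exists (slice 1 h).
    by rewrite -(hm h)//; apply: agreeW gh; rewrite leq_maxl.
  by apply: hm'; apply: agreeW gh; rewrite leq_maxr.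
- move=> g i; have [m hm] := s0 g 0%N.
  have [m' hm'] := baire_continuous_comp (cphi (slice 0 g 0%N)) s1 g i.
  exists (maxn m m') => h gh; rewrite hm; last by apply: agreeW gh; rewrite leq_maxl.
  by apply: hm'; apply: agreeW gh; rewrite leq_maxr.
apply/seteqP; split=> [g [n _]|_ [h /= Fh <-]].
  rewrite SE => -[f Ff <-].
  exists (merge_slices (fun k => if k is 0%N then fun=> n else f)); rewrite /= !slice_merge//.
by exists (slice 0 h 0%N) => //; rewrite SE; exists (slice 1 h).
Qed.

Lemma analytic_countable_bigcup (J : countType) (D : set J) (S : J -> set baire) :
  (forall i, D i -> analytic (S i)) -> analytic (\bigcup_(i in D) S i).
Proof.
move=> aS; have -> : \bigcup_(i in D) S i =
    \bigcup_n (if choice.unpickle n is Some i then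
                 if i \in D then S i else set0 else set0).
  apply/seteqP; split=> [g [i Di Sg]|g [n _]].
    by exists (choice.pickle i) => //; rewrite choice.pickleK mem_set.
  case: choice.unpickle => [i|//]; case: ifPn => [|//]; rewrite inE => Di Sg.
  by exists i.
apply: analytic_bigcup => n; case: choice.unpickle => [i|]; last exact: analytic0.
by case: ifPn; [rewrite inE; exact: aS|move=> _; exact: analytic0].
Qed.

Lemma analytic_countable_bigcap (J : countType) (D : set J) (S : J -> set baire) :
  (forall i, D i -> analytic (S i)) -> analytic (\bigcap_(i in D) S i).
Proof.
move=> aS; have -> : \bigcap_(i in D) S i =
    \bigcap_n (if choice.unpickle n is Some i then
                 if i \in D then S i else setT else setT).
  apply/seteqP; split=> [g Sg n _|g Sg i Di].
    by case: choice.unpickle => [i|//]; case: ifPn => [|//]; rewrite inE => /Sg.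
  by have := Sg (choice.pickle i) I; rewrite choice.pickleK mem_set.
apply: analytic_bigcap => n; case: choice.unpickle => [i|]; last exact: analytic_closed.
by case: ifPn; [rewrite inE; exact: aS|move=> _; exact: analytic_closed].
Qed.

Definition baire_sum S T : set baire :=
  [set h | exists f g, [/\ S f, T g & h = (fun n => f n + g n)%N]].

Lemma analytic_sum S T : analytic S -> analytic T -> analytic (baire_sum S T).
Proof.
have s0 := @baire_continuous_slice 0; have s1 := @baire_continuous_slice 1.
move=> aS aT; have -> : baire_sum S T =
    (fun h n => slice 0 h n + slice 1 h n)%N @` (slice 0 @^-1` S `&` slice 1 @^-1` T).
  apply/seteqP; split=> [_ [f [g [Sf Tg ->]]]|_ [h [Sh Th] <-]].
    exists (merge_slices (fun k => if k is 0%N then f else g)).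
      by split; rewrite /= slice_merge.
    by rewrite !slice_merge.
  by exists (slice 0 h), (slice 1 h).
apply: analytic_image; first exact: baire_continuous_add.
by apply: analyticI; exact: analytic_preimage.
Qed.

Lemma seq_path_of_step (alive : seq nat -> Prop) : alive [::] ->
  (forall t, alive t -> exists v, alive (rcons t v)) ->
  exists g : baire, forall n, alive (mkseq g n).
Proof.
move=> alive0 step.
have /choice[next nextP] : forall t, exists v, alive t -> alive (rcons t v).
  move=> t; have [/step[v av]|nat_] := pselect (alive t); first by exists v.
  by exists 0%N.
pose tr n := iter n (fun t => rcons t (next t)) [::].
have tr_alive n : alive (tr n) by elim: n => // n IH; exact: nextP.
exists (fun n => next (tr n)) => n.
suff -> : mkseq (fun m => next (tr m)) n = tr n by [].
by elim: n => // n IH; rewrite mkseqS IH.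
Qed.

(* Koenig's lemma: the [h]'s form a finitely branching tree. *)
Lemma baire_compact (s : baire) (G : nat -> set baire) :
  (forall n, baire_closed (G n)) -> (forall m n, (m <= n)%N -> G n `<=` G m) ->
  (forall n h, G n h -> forall i, (i < n)%N -> (h i <= s i)%N) ->
  (forall n, G n !=set0) -> exists h, forall n, G n h.
Proof.
move=> cG decG bG G0.
pose alive (t : seq nat) := forall n, exists2 h, G n h & agree (size t) (nth 0%N t) h.
have step t : alive t -> exists v, alive (rcons t v).
  move=> at_; apply: contrapT => dead.
  have /choice[N NP] : forall v, exists n, forall h, G n h ->
      ~ agree (size (rcons t v)) (nth 0%N (rcons t v)) h.
    move=> v; apply: contrapT => nd; apply: dead; exists v => n.
    apply: contrapT => nh; apply: nd; exists n => h Gh ah; apply: nh.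
    by exists h.
  (* At level [M] the bound on coordinate [size t] is in force, and every value that it allows has
     been refuted. *)
  pose M := maxn (size t).+1 (\max_(v < (s (size t)).+1) N v).
  have [h Gh ah] := at_ M.
  have hs : (h (size t) <= s (size t))%N by apply: bG Gh _ _; rewrite leq_maxl.
  apply: (NP (h (size t)) h).
    apply: decG Gh; apply: leq_trans (leq_maxr _ _).
    exact: (@leq_bigmax _ (fun v : 'I_(s (size t)).+1 => N v) (Ordinal (hs : (_ < _.+1)%N))).
  move=> i; rewrite size_rcons nth_rcons ltnS leq_eqVlt => /orP[/eqP ->|it].
    by rewrite ltnn eqxx.
  by rewrite it; exact: ah.
have [|g g_alive] := @seq_path_of_step alive _ step.
  by move=> n; have [h Gh] := G0 n; exists h.
exists g => n; apply: cG => m; have [h Gh ah] := g_alive m n.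
exists h => // i im; rewrite -ah ?size_mkseq//.
by rewrite nth_mkseq.
Qed.

End analytic_sets.

(** * Outer measure and capacitability *)

Section finite_measure_limits.
Context {d : measure_display} {T : measurableType d} {R : realType}
  (mu : probability T R).

Lemma cvg_fine_measure (X : nat -> set T) (Y : set T) :
  mu (X n) @[n --> \oo] --> mu Y -> measurable Y ->
  (fun n => fine (mu (X n))) @ \oo --> fine (mu Y).
Proof.
move=> XY mY.
have /fine_cvgP[] : mu (X n) @[n --> \oo] --> (fine (mu Y))%:E; last by [].
by rewrite fineK// fin_num_measure.
Qed.

(** [L] is the lim inf of the sets [H n], an increasing union of sets each contained in some
    [H n]. *)
Lemma measure_liminf_le (H : nat -> set T) (c : R) :
  (forall n, measurable (H n)) -> (forall n, mu (H n) <= c%:E)%E ->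
  let L := \bigcup_n \bigcap_(m in [set m | (n <= m)%N]) H m in
  measurable L /\ (mu L <= c%:E)%E.
Proof.
move=> mH Hc L; pose G n := \bigcap_(m in [set m | (n <= m)%N]) H m.
have mG n : measurable (G n) by apply: bigcap_measurableType => m _; exact: mH.
have mL : measurable L by apply: bigcup_measurable => n _; exact: mG.
split=> //; rewrite -[mu L]fineK ?fin_num_measure// lee_fin.
have GL : mu (G n) @[n --> \oo] --> mu L.
  apply: nondecreasing_cvg_mu => // m n mn; apply/subsetPset => x Gx k /= nk.
  by apply: Gx; exact: leq_trans nk.
apply: (cvgr_to_le (cvg_fine_measure GL mL)); apply: nearW => n.
rewrite -lee_fin fineK ?fin_num_measure//; apply: le_trans (Hc n).
by apply: le_measure; rewrite ?inE// => x; apply => /=.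
Qed.

Definition outer_gt (c : R) (S : set T) :=
  forall H, measurable H -> S `<=` H -> (c%:E < mu H)%E.

(** Outer measure is continuous from below even along nonmeasurable sets: if every [S n] had a cover
    of measure at most [c], the lim inf of these covers would cover the union. *)
Lemma outer_gt_bigcup (c : R) (S : nat -> set T) :
  (forall m n, (m <= n)%N -> S m `<=` S n) -> outer_gt c (\bigcup_n S n) ->
  exists n, outer_gt c (S n).
Proof.
move=> ndS big; apply: contrapT => nbig.
have /choice[H HP] : forall n, exists H,
    [/\ measurable H, S n `<=` H & (mu H <= c%:E)%E].
  move=> n; apply: contrapT => nH; apply: nbig; exists n => H mH SH.
  by rewrite ltNge; apply/negP => Hc; apply: nH; exists H.
have [mL Lc] : let L := \bigcup_n \bigcap_(m in [set m | (n <= m)%N]) H m in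
    measurable L /\ (mu L <= c%:E)%E.
  by apply: measure_liminf_le => n; case: (HP n).
suff /(big _ mL) : \bigcup_n S n `<=` \bigcup_n \bigcap_(m in [set m | (n <= m)%N]) H m.
  by rewrite ltNge Lc.
move=> x [n _ Sx].
by exists n => // m /= nm; have [_ SH _] := HP m; exact/SH/(ndS _ _ nm).
Qed.

End finite_measure_limits.

Section capacity.
Context {d : measure_display} {T : measurableType d} {R : realType}
  (mu : probability T R) (code : T -> baire).
Hypothesis mcode : forall i v, measurable [set x | code x i = v].

Lemma measurable_finitary n (D : set baire) :
  (forall g h, agree n g h -> D g -> D h) -> measurable [set x | D (code x)].
Proof.
move=> Dn; have -> : [set x | D (code x)] =
    \bigcup_(t : n.-tuple nat) (if `[< D (nth 0%N t) >]
      then \bigcap_(i in [set i | (i < n)%N]) [set x | code x i = nth 0%N t i]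
      else set0).
  apply/seteqP; split=> [x /= Dx|x [t _]].
    exists (mktuple (fun i : 'I_n => code x i)) => //.
    have nthE i : (i < n)%N ->
        nth 0%N (mktuple (fun i : 'I_n => code x i)) i = code x i.
      by move=> i_n; rewrite -[i]/(val (Ordinal i_n)) -tnth_nth tnth_mktuple.
    case: asboolP => [_ i /= i_n|]; first by rewrite nthE.
    by case; apply: Dn Dx => i i_n; rewrite nthE.
  case: asboolP => // Dt xt; apply: Dn Dt => i i_n; exact/esym/xt.
apply: countable_bigcupT_measurable => [//|t].
case: ifP => // _; apply: bigcap_measurableType => i _; exact: mcode.
Qed.

(** Bounding and matching only the first [n] coordinates makes the set measurable, although [h]
    ranges over all of [F]. *)
Definition approx (F : set baire) (phi : baire -> baire) (s : baire) n : set T :=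
  [set x | exists h, [/\ F h, forall i, (i < n)%N -> (h i <= s i)%N &
                         agree n (phi h) (code x)]].

Context (S : set T) (F : set baire) (phi : baire -> baire).
Hypotheses (F_closed : baire_closed F) (phi_cont : baire_continuous phi).
Hypothesis SE : forall x, S x <-> exists2 h, F h & phi h = code x.

Lemma measurable_approx s n : measurable (approx F phi s n).
Proof.
apply: (@measurable_finitary n [set g | exists h,
  [/\ F h, forall i, (i < n)%N -> (h i <= s i)%N & agree n (phi h) g]]).
move=> g g' gg' [h [Fh hs hg]]; exists h; split=> //.
exact: agree_trans gg'.
Qed.

Lemma approx_decreasing s m n : (m <= n)%N ->
  approx F phi s n `<=` approx F phi s m.
Proof.
move=> mn x [h [Fh hs hx]]; exists h; split=> //; last exact: agreeW hx.
by move=> i im; apply: hs; exact: leq_trans mn.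
Qed.

(** The witnesses [h] vary with the level; compactness of the sequences below [s] gives a single
    one, and continuity makes its image equal to the code. *)
Lemma bigcap_approx s : \bigcap_n approx F phi s n `<=` S.
Proof.
move=> x xs; apply/SE.
pose G n : set baire := [set h | [/\ F h, forall i, (i < n)%N -> (h i <= s i)%N &
                         agree n (phi h) (code x)]].
have [n|m n mn h [Fh hs hx]|n h [_ ? _] //|n|h hG] := @baire_compact s G.
- move=> g gG; split.
  + by apply: F_closed => m; have [h [Fh _ _] gh] := gG m; exists h.
  + move=> i i_n; have [h [_ hs _] gh] := gG i.+1; rewrite gh//; exact: hs.
  + have [m hm] := baire_continuous_agree g n phi_cont.
    have [h [_ _ hx] /hm gh] := gG m; exact: agree_trans hx.
- split=> //; last exact: agreeW hx.
  by move=> i im; apply: hs; exact: leq_trans mn.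
- by have [h hG] := xs n I; exists h.
exists h; first by have [] := hG 0%N.
by apply/funext => i; have [_ _] := hG i.+1; apply.
Qed.

(* Capacitability: the bounds [s i] are chosen one after the other, keeping the
   outer measure of the part of [S] coded below them greater than [c]. *)
Lemma approx_outer_gt (c : R) : outer_gt mu c S ->
  exists s, forall n, (c%:E < mu (approx F phi s n))%E.
Proof.
move=> big.
pose Sx (t : seq nat) : set T := [set x | exists2 h,
  F h /\ (forall i, (i < size t)%N -> (h i <= nth 0%N t i)%N) & phi h = code x].
have Sx0 : outer_gt mu c (Sx [::]).
  suff -> : Sx [::] = S by [].
  apply/seteqP; split=> x; last by move=> /SE[h Fh hx]; exists h.
  by move=> [h [Fh _] hx]; apply/SE; exists h.
have step t : outer_gt mu c (Sx t) -> exists v, outer_gt mu c (Sx (rcons t v)).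
  move=> bt; apply: outer_gt_bigcup => [m n mn x [h [Fh ht] hx]|H mH SH].
    exists h => //; split=> // i it; apply: leq_trans (ht i _) _.
      by move: it; rewrite !size_rcons.
    by rewrite !nth_rcons; case: ifP => // _; case: ifP.
  apply: bt => // x [h [Fh ht] hx]; apply: SH; exists (h (size t)) => //.
  exists h => //; split=> // i; rewrite size_rcons nth_rcons ltnS leq_eqVlt.
  by case: eqP => [->|_ /= it]; rewrite ?ltnn ?eqxx// it ht.
have [s hs] := seq_path_of_step Sx0 step.
exists s => n; apply: (hs n); first exact: measurable_approx.
move=> x [h [Fh ht] hx]; exists h; split=> // [i i_n|i _]; last by rewrite hx.
by have := ht i; rewrite size_mkseq nth_mkseq//; apply.
Qed.

End capacity.

Section analytic_completed.
Context {d : measure_display} {T : measurableType d} {R : realType}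
  (mu : probability T R) (code : T -> baire).
Hypothesis mcode : forall i v, measurable [set x | code x i = v].
Hypothesis code_inj : injective code.

Lemma analytic_codedE (S : set T) (F : set baire) (phi : baire -> baire) : code @` S = phi @` F ->
  forall x, S x <-> exists2 h, F h & phi h = code x.
Proof.
move=> SF x; split=> [Sx|xF].
  by have : (code @` S) (code x) by [exists x]; rewrite SF => -[h Fh hx]; exists h.
have : (phi @` F) (code x) by [].
by rewrite -SF => -[y Sy /code_inj <-].
Qed.

Lemma analytic_inner (S : set T) (c : R) : analytic (code @` S) -> outer_gt mu c S ->
  exists C, [/\ measurable C, C `<=` S & (c%:E <= mu C)%E].
Proof.
move=> [F [phi [cF cphi SF]]]; have SE := analytic_codedE SF.
move=> /(approx_outer_gt mcode SE)[s hs].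
have mA := measurable_approx mcode F phi s.
exists (\bigcap_n approx code F phi s n); split.
- by apply: bigcap_measurableType.
- exact: bigcap_approx.
have mC : measurable (\bigcap_n approx code F phi s n) by apply: bigcap_measurableType.
have AC : mu (approx code F phi s n) @[n --> \oo] --> mu (\bigcap_n approx code F phi s n).
  apply: nonincreasing_cvg_mu => //; first by rewrite ltey_eq fin_num_measure.
  by move=> m n mn; apply/subsetPset; exact: approx_decreasing.
rewrite -[mu (\bigcap_n _)]fineK ?fin_num_measure// lee_fin.
apply: (cvgr_to_ge (cvg_fine_measure AC mC)); apply: nearW => n.
by rewrite -lee_fin fineK ?fin_num_measure// ltW.
Qed.

(** Covers of [S] have measures approaching [inf M], the outer measure; by capacitability, so do
    measurable subsets of [S]. The countable union of the subsets and the countable intersection of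
    the covers then differ by a null set. *)
Lemma analytic_completed (S : set T) : analytic (code @` S) ->
  completed_algebra_gen mu S.
Proof.
move=> aS.
pose M : set R := [set fine (mu H) | H in [set H | measurable H /\ S `<=` H]].
have M0 : has_inf M.
  split; first by exists (fine (mu setT)), setT.
  by exists 0 => _ [H [mH _] <-]; exact: fine_ge0.
have e0 n : 0 < n.+1%:R^-1 :> R by rewrite invr_gt0.
have /choice[H HP] : forall n, exists H, [/\ measurable H, S `<=` H &
    (mu H <= (inf M + n.+1%:R^-1)%:E)%E].
  move=> n; have [_ [H [mH SH] <-] hH] := inf_adherent (e0 n) M0.
  by exists H; split=> //; rewrite -[mu H]fineK ?fin_num_measure// lee_fin ltW.
have /choice[C CP] : forall n, exists C, [/\ measurable C, C `<=` S &
    ((inf M - n.+1%:R^-1)%:E <= mu C)%E].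
  move=> n; apply: analytic_inner => // G mG SG.
  rewrite -[mu G]fineK ?fin_num_measure// lte_fin.
  apply: (@lt_le_trans _ _ (inf M)); first by rewrite gtrBl.
  by apply: ge_inf; [case: M0|exists G].
pose A := \bigcup_n C n; pose B := \bigcap_n H n.
have mA : measurable A by apply: bigcup_measurable => n _; case: (CP n).
have mB : measurable B by apply: bigcap_measurableType => n _; case: (HP n).
have AS : A `<=` S by move=> x [n _]; case: (CP n) => _ + _; exact.
have SB : S `<=` B by move=> x Sx n _; case: (HP n) => _ + _; exact.
exists A => //; exists (S `\` A); last by rewrite setDUK.
exists (B `\` A); split; [exact: measurableD| |exact: setSD].
have BA : mu (B `\` A) = (mu B - mu A)%E.
  rewrite measureD// ?(setIidr (subset_trans AS SB))//.
  by rewrite ltey_eq fin_num_measure.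
transitivity (mu B - mu A)%E; first exact: BA.
have [a aE] : exists a, mu A = a%:E by exists (fine (mu A)); rewrite fineK// fin_num_measure.
have [b bE] : exists b, mu B = b%:E by exists (fine (mu B)); rewrite fineK// fin_num_measure.
have muB n : (mu B <= (inf M + n.+1%:R^-1)%:E)%E.
  by have [mH _] := HP n; apply: le_trans; apply: le_measure; rewrite ?inE// => x; apply.
have muA n : ((inf M - n.+1%:R^-1)%:E <= mu A)%E.
  have [mC _] := CP n; move=> /le_trans; apply; apply: le_measure; rewrite ?inE// => x Cx.
  by exists n.
have AB : (mu A <= mu B)%E by apply: le_measure; rewrite ?inE//; exact: subset_trans SB.
rewrite aE bE in muA muB AB *; move: AB; rewrite lee_fin => ab; apply/eqP; rewrite -EFinB eqe subr_eq0.
rewrite eq_le ab andbT; apply/ler_addgt0Pr => e e_gt0.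
have [n hn] : exists n, 2 * n.+1%:R^-1 < e.
  have [n _ hn] := near_infty_natSinv_lt (PosNum (divr_gt0 e_gt0 (ltr0n R 2))).
  by exists n; have := hn n (leqnn n); rewrite /= ltr_pdivlMr// mulrC.
move: (muA n) (muB n) hn; rewrite !lee_fin.
by move: (n.+1%:R^-1) (inf M) => u m; lra.
Qed.

End analytic_completed.

(** * Codes of points and of counting measures *)

Section coded_sigma_algebra.
Context {T : Type} (code : T -> baire) (code_inj : injective code).

(** Complements of analytic sets need not be analytic, so the induction carries a set together with
    its complement. Injectivity of [code] lets images commute with countable intersections. *)
Lemma analytic_generated (G : set (set T)) : analytic (code @` setT) ->
  (forall A, G A -> analytic (code @` A) /\ analytic (code @` ~` A)) ->
  forall A, <<s G >> A -> analytic (code @` A) /\ analytic (code @` ~` A).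
Proof.
move=> aT aG; apply: smallest_sub => [|A /aG//].
split=> [|A|A aA].
- by rewrite image_set0 setC0; split=> //; exact: analytic0.
- by rewrite setTD setCK => -[].
- split.
    rewrite image_bigcup; apply: analytic_bigcup => n; exact: (aA n).1.
  rewrite setC_bigcup (_ : code @` _ = \bigcap_n code @` ~` A n).
    by apply: analytic_bigcap => n; exact: (aA n).2.
  apply/seteqP; split=> [_ [x Ax <-] n _|h Ah]; first by exists x => //; exact: Ax.
  have [x _ xh] := Ah 0%N I; exists x => // n _.
  have [y Ay yh] := Ah n I; suff -> : x = y by [].
  by apply: code_inj; rewrite xh yh.
Qed.

End coded_sigma_algebra.

Section base.
Context {E : topologicalType} (E_lc : locally_compact [set: E])
  (E_sc : @second_countable E) (E_T2 : hausdorff_space E).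

Lemma countable_base : exists V : nat -> set E, (forall i, open (V i)) /\
  forall x U, nbhs x U -> exists2 i, V i x & V i `<=` U.
Proof.
have [B /countable_injP[f f_inj] [B_open B_basis]] := E_sc.
have /choice[V VP] : forall n, exists U, open U /\ forall W, B W -> f W = n -> U = W.
  move=> n; have [[W BW fW]|nW] := pselect (exists2 W, B W & f W = n).
    exists W; split; first exact: B_open.
    by move=> W' BW' fW'; apply: f_inj; rewrite ?inE// fW.
  exists set0; split; first exact: open0.
  by move=> W BW fW; exfalso; apply: nW; exists W.
exists V; split=> [i|x U /B_basis[W [BW Wx] WU]]; first by case: (VP i).
by exists (f W); have [_ /(_ W BW erefl) ->] := VP (f W).
Qed.

Context (V : nat -> set E) (openV : forall i, open (V i))
  (baseV : forall x U, nbhs x U -> exists2 i, V i x & V i `<=` U).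

Lemma base_compact_closure x U : nbhs x U ->
  exists i, [/\ V i x, closure (V i) `<=` U & compact (closure (V i))].
Proof.
move=> xU; have [K] := E_lc (I : [set: E] x); rewrite withinET => xK [cK clK].
have [W xW WUK] : filter_from (nbhs x) closure (U `&` K).
  by apply: (compact_regular E_T2 cK xK); exact: filterI.
have [i Vix ViW] := baseV xW.
have Vi_UK : closure (V i) `<=` U `&` K by apply: subset_trans WUK; exact: closure_subset.
exists i; split=> //; first by move=> y /Vi_UK[].
apply: (subclosed_compact _ cK); first exact: closed_closure.
by move=> y /Vi_UK[].
Qed.

Definition point_code (x : E) : baire := fun i => (x \in V i).

Lemma point_code1 x i : point_code x i = 1%N <-> V i x.
Proof.
rewrite /point_code; have [xV|xV] := boolP (x \in V i).
  by split=> // _; exact: set_mem.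
by split=> // Vx; rewrite mem_set in xV.
Qed.

(* The point is a cluster point of points matching longer and longer prefixes
   of its code; the last two conditions keep it in a compact set and in the
   open sets claimed by the code. *)
Lemma point_code_range : range point_code =
  [set a | forall n, exists2 x, [set: E] x & agree n a (point_code x)] `&`
  (\bigcup_(i in [set i | compact (closure (V i))]) [set a | a i = 1%N] `&`
   \bigcap_i ([set a | a i <> 1%N] `|`
     \bigcup_(j in [set j | closure (V j) `<=` V i]) [set a | a j = 1%N])).
Proof.
apply/seteqP; split=> [_ [x _ <-]|a [a_pre [[i0 /= ci0 ai0] a_reg]]].
  split=> [n|]; first by exists x.
  split.
    by have [i [/point_code1 ? _ ?]] := base_compact_closure (filterT : nbhs x setT); exists i.
  move=> i _; have [Vix|nVix] := pselect (V i x); last by left => /= /point_code1.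
  have [|j [/point_code1 ? ? _]] := @base_compact_closure x (V i).
    by apply: open_nbhs_nbhs; split.
  by right; exists j.
have /choice[x xP] : forall n, exists x, agree n a (point_code x).
  by move=> n; have [x _ ax] := a_pre n; exists x.
pose F := x @ \oo.
have FV i : a i = 1%N -> F (V i).
  move=> ai; exists i.+1 => // n /= i_n; apply/point_code1.
  by rewrite -(xP n).
have FnV i : a i <> 1%N -> F (~` V i).
  move=> ai; exists i.+1 => // n /= i_n /point_code1.
  by rewrite -(xP n).
have [|p [_ Fp]] := ci0 F _; first by apply: filterS (FV _ ai0); exact: subset_closure.
exists p => //; apply/funext => i.
have [ai|nai] := pselect (a i = 1%N).
  rewrite ai; apply/point_code1. have [//|[j /= jV aj]] := a_reg i I.
  by apply: jV => B pB; exact: Fp (FV _ aj) pB.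
have nVp : ~ V i p.
  move=> Vip; have [|q [nVq Vq]] := Fp _ (V i) (FnV _ nai); last exact: nVq.
  by apply: open_nbhs_nbhs; split.
rewrite [in LHS]/point_code (memNset nVp); move: nai.
by rewrite (xP i.+1 i (ltnSn i)) /point_code; case: (_ \in _).
Qed.

Lemma analytic_coordinate i (D : set nat) : analytic [set a : baire | D (a i)].
Proof.
apply/analytic_closed; apply: (@baire_closed_finitary i.+1) => g h gh /=.
by rewrite gh.
Qed.

Lemma analytic_point_range : analytic (range point_code).
Proof.
rewrite point_code_range; apply: analyticI.
  apply: analytic_closed => g gF n; have [h hF gh] := gF n; have [x _ hx] := hF n.
  by exists x => //; exact: agree_trans hx.
apply: analyticI.
  apply: analytic_countable_bigcup => i _; exact: (analytic_coordinate i [set 1%N]).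
apply: analytic_bigcap => i; rewrite -bigcup2E; apply: analytic_bigcup => -[|[|n]] /=.
- exact: (analytic_coordinate i (~` [set 1%N])).
- apply: analytic_countable_bigcup => j _; exact: (analytic_coordinate j [set 1%N]).
- exact: analytic0.
Qed.

(** When [L] lists the atoms of a measure, the mass of such a [V i] is the multiplicity of [x];
    codes thus determine multiplicities. *)
Lemma base_isolates (L : seq E) x :
  exists2 i, V i x & forall y, y \in L -> V i y -> y = x.
Proof.
have : nbhs x [set z | forall y, y \in L -> y != x -> z != y].
  elim: L => [|y L IH]; first by apply: nearW => z y.
  have [->|yx] := eqVneq y x.
    apply: filterS IH => z zL w; rewrite inE => /orP[/eqP ->|/zL]; last exact.
    by rewrite eqxx.
  have xy : x != y by rewrite eq_sym.
  have [U [oU /set_mem Ux /set_mem Uy]] := hausdorff_accessible E_T2 xy.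
  have xU : nbhs x U by exact: open_nbhs_nbhs.
  apply: filterS2 xU IH => z Uz zL w; rewrite inE => /orP[/eqP -> _|/zL]; last exact.
  by apply: contra_not_neq Uy => <-.
move=> /baseV[i Vix ViL]; exists i => // y yL /ViL/(_ y yL).
by rewrite eqxx; case: eqVneq => // _ /(_ isT).
Qed.

Lemma point_code_inj : injective point_code.
Proof.
move=> x y xy; have [i Vix Viy] := base_isolates [:: y] x.
apply/esym/Viy; first by rewrite inE.
by apply/point_code1; rewrite -xy; apply/point_code1.
Qed.

Lemma analytic_borel (B : set E) : borel B ->
  analytic (point_code @` B) /\ analytic (point_code @` ~` B).
Proof.
move: B; apply: analytic_generated; first exact: point_code_inj.
  exact: analytic_point_range.
move=> O oO; pose D := [set i | V i `<=` O].
have OE x : O x <-> exists2 i, D i & V i x.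
  split=> [Ox|[i iD /iD//]].
  by have [|i Vix ViO] := @baseV x O; [exact: open_nbhs_nbhs|exists i].
split.
- have -> : point_code @` O = range point_code `&` \bigcup_(i in D) [set a | a i = 1%N].
    apply/seteqP; split=> [_ [x /OE[i Di Vix] <-]|_ [[x _ <-] [i Di /point_code1 Vix]]].
      by split; [exists x|exists i => //; exact/point_code1].
    by exists x => //; apply/OE; exists i.
  apply: analyticI; first exact: analytic_point_range.
  by apply: analytic_countable_bigcup => i _; exact: (analytic_coordinate i [set 1%N]).
- have -> : point_code @` (~` O) =
      range point_code `&` \bigcap_(i in D) [set a | a i <> 1%N].
    apply/seteqP; split=> [_ [x nOx <-]|_ [[x _ <-] nV]].
      split; first by exists x.
      by move=> i Di /point_code1 Vix; apply: nOx; apply/OE; exists i.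
    by exists x => // /OE[i Di /point_code1]; exact: nV.
  apply: analyticI; first exact: analytic_point_range.
  apply: analytic_countable_bigcap => i _.
  exact: (analytic_coordinate i (~` [set 1%N])).
Qed.

End base.

Section counting_measures.
Context {E : topologicalType}.
Implicit Types (xi nu : fcmeasure E) (L : seq E) (B : set E).

Definition of_seq L : fcmeasure E := seq_mset L.

Lemma of_seqE L x : (of_seq L : multiset E) x = count_mem x L.
Proof. exact: mset_seqE. Qed.

Lemma of_seq_surj xi : exists L, xi = of_seq L.
Proof. by exists (xi : multiset E); rewrite /of_seq seq_mset_id. Qed.

Lemma fcmeasureP xi nu :
  (xi : multiset E) =1 (nu : multiset E) -> xi = nu.
Proof. by move=> /msetP. Qed.

Lemma fcintegral_of_seq (R : realType) L (f : E -> R) :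
  fcintegral (of_seq L) f = \sum_(x <- L) f x.
Proof.
transitivity (\sum_(x <- (of_seq L : multiset E)) f x).
  by rewrite big_mset; apply: eq_bigr => x _; rewrite mulr_natl.
exact/perm_big/perm_eq_seq_mset.
Qed.

Lemma fcmass_of_seq L B : fcmass (of_seq L) B = (\sum_(x <- L) (x \in B))%N.
Proof.
transitivity (\sum_(x <- (of_seq L : multiset E) | x \in B) 1)%N.
  by rewrite sum_mset /fcmass; apply: eq_bigr => x _; rewrite muln1.
rewrite (perm_big _ (perm_eq_seq_mset L))/= big_mkcond /=.
by apply: eq_bigr => x _; case: (_ \in _).
Qed.

Lemma fcmass_isolated xi B x : B x ->
  (forall y, y \in finsupp (xi : multiset E) -> B y -> y = x) ->
  fcmass xi B = (xi : multiset E) x.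
Proof.
move=> Bx isoB; have [xS|xS] := boolP (x \in finsupp (xi : multiset E)); last first.
  rewrite /fcmass big_seq_cond big1; first by rewrite fsfun_dflt.
  move=> y /andP[yS /set_mem By]; have := isoB y yS By => yx.
  by rewrite yx (negPf xS) in yS.
rewrite /fcmass (big_rem x)//= mem_set//= big_seq_cond big1 ?addn0// => y.
move=> /andP[]; rewrite mem_rem_uniq ?fset_uniq// inE => /andP[/eqP yx yS] yB.
by case: yx; apply: isoB => //; exact: set_mem.
Qed.

Lemma fcintegral_fcdiff (R : realType) xi nu (f : E -> R) :
  fcintegral (fcdiff xi nu) f = \sum_(x <- finsupp (xi : multiset E))
    ((xi : multiset E) x - (nu : multiset E) x)%:R * f x.
Proof.
transitivity (\sum_(x <- finsupp (xi : multiset E))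
    ((fcdiff xi nu : multiset E) x)%:R * f x).
  apply: big_fset_incl => [|x _].
    apply/fsubsetP => x; rewrite !msuppE /fcdiff in_msetB => h.
    by rewrite in_mset; exact: leq_ltn_trans h.
  by rewrite msuppE -mset_eq0 => /eqP ->; exact: mul0r.
by apply: eq_bigr => x _; rewrite /fcdiff msetE2.
Qed.

Lemma fcintegral_le (R : realType) xi nu (f : E -> R) : (forall x, 0 <= f x) ->
  (forall x, (xi : multiset E) x <= (nu : multiset E) x)%N ->
  fcintegral xi f <= fcintegral nu f.
Proof.
move=> f0 xinu; have -> : fcintegral xi f =
    \sum_(x <- finsupp (nu : multiset E)) ((xi : multiset E) x)%:R * f x.
  apply: big_fset_incl => [|x _].
    apply/fsubsetP => x; rewrite !msuppE !in_mset => h.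
    exact: leq_trans (xinu x).
  by rewrite msuppE -mset_eq0 => /eqP ->; exact: mul0r.
by apply: ler_sum => x _; apply: ler_wpM2r => //; rewrite ler_nat.
Qed.

End counting_measures.

Section measure_codes.
Context {E : topologicalType} (E_lc : locally_compact [set: E])
  (E_T2 : hausdorff_space E).
Context (V : nat -> set E) (openV : forall i, open (V i))
  (baseV : forall x U, nbhs x U -> exists2 i, V i x & V i `<=` U).

Local Notation point_code := (point_code V).

Definition measure_code (xi : fcmeasure E) : baire := fun i => fcmass xi (V i).

Definition seq_code (L : seq E) : baire := fun i => (\sum_(x <- L) point_code x i)%N.

Lemma measure_code_of_seq L : measure_code (of_seq L) = seq_code L.
Proof. by apply/funext => i; rewrite /measure_code fcmass_of_seq. Qed.

Lemma measure_code_inj : injective measure_code.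
Proof.
move=> xi nu xinu; apply: fcmeasureP => x.
have [i Vix iso] := base_isolates E_T2 baseV
  (finsupp (xi : multiset E) ++ finsupp (nu : multiset E)) x.
have <- : fcmass xi (V i) = (xi : multiset E) x.
  by apply: fcmass_isolated => // y yS; apply: iso; rewrite mem_cat yS.
have <- : fcmass nu (V i) = (nu : multiset E) x.
  by apply: fcmass_isolated => // y yS; apply: iso; rewrite mem_cat yS orbT.
by have /(congr1 (fun h => h i)) := xinu.
Qed.

Lemma measure_codeD (xi nu : fcmeasure E) :
  measure_code ((xi : multiset E) `+` (nu : multiset E))%mset =
  (fun i => measure_code xi i + measure_code nu i)%N.
Proof.
have [L ->] := of_seq_surj xi; have [L' ->] := of_seq_surj nu.
have -> : (of_seq L `+` of_seq L')%mset = of_seq (L ++ L').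
  by apply/msetP => x; rewrite msetE2 !of_seqE count_cat.
rewrite !measure_code_of_seq; apply/funext => i.
by rewrite /seq_code big_cat.
Qed.

Fixpoint sum_codes (B : set E) (k : nat) : set baire :=
  if k is k'.+1 then baire_sum (point_code @` B) (sum_codes B k')
  else [set fun=> 0%N].

Lemma sum_codesP B k h : sum_codes B k h <->
  exists L, [/\ size L = k, forall x, x \in L -> B x & h = seq_code L].
Proof.
elim: k h => [|k IH] h /=; split.
- move=> ->; exists [::]; split=> //; apply/funext => i.
  by rewrite /seq_code big_nil.
- move=> [L [/size0nil -> _ ->]]; apply/funext => i.
  by rewrite /seq_code big_nil.
- move=> [_ [g [[x Bx <-] /IH[L [Lk LB ->]] ->]]]; exists (x :: L); split.
  + by rewrite /= Lk.
  + by move=> y; rewrite inE => /orP[/eqP ->//|/LB].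
  + by apply/funext => i; rewrite /seq_code big_cons.
- case=> -[|x L] [] //= [Lk] LB ->; exists (point_code x), (seq_code L); split.
  + by exists x => //; apply: LB; rewrite inE eqxx.
  + by apply/IH; exists L; split=> // y yL; apply: LB; rewrite inE yL orbT.
  + by apply/funext => i; rewrite /seq_code big_cons.
Qed.

Lemma analytic_sum_codes B k : analytic (point_code @` B) ->
  analytic (sum_codes B k).
Proof.
move=> aB; elim: k => [|k IH] /=; last exact: analytic_sum.
rewrite (_ : [set fun=> 0%N] = [set h | id h = (fun=> (fun=> 0%N)) h])//.
by apply/analytic_closed/baire_closed_eq; [exact: baire_continuous_id|exists 0%N].
Qed.

(** Split a measure into its [u] points in [B] and its [v] points outside. Only countably many pairs
    [(u, v)] occur, and each gives a sum of analytic sets of point codes. *)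
Lemma fcmass_event_codes B (U : set nat) :
  measure_code @` [set xi | U (fcmass xi B)] =
  \bigcup_(uv in [set uv : nat * nat | U uv.1])
    baire_sum (sum_codes B uv.1) (sum_codes (~` B) uv.2).
Proof.
have massE L L' : (forall x, x \in L -> B x) -> (forall x, x \in L' -> ~ B x) ->
    fcmass (of_seq (L ++ L')) B = size L.
  move=> LB LB'; rewrite fcmass_of_seq big_cat /= [X in (_ + X)%N]big_seq.
  rewrite [X in (_ + X)%N]big1 ?addn0.
    by rewrite big_seq (eq_bigr (fun=> 1%N)) -?big_seq ?sum1_size// => x /LB/mem_set ->.
  by move=> x /LB' nBx; rewrite memNset.
apply/seteqP; split=> [_ [xi /= Uxi <-]|_ [[u v] /= Uu [_ [_ [/sum_codesP[L [Lu LB ->]]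
    /sum_codesP[L' [Lv LB' ->]] ->]]]]].
  have [L xiL] := of_seq_surj xi.
  pose L1 := [seq x <- L | x \in B]; pose L2 := [seq x <- L | x \notin B].
  have LB1 x : x \in L1 -> B x by rewrite mem_filter => /andP[/set_mem].
  have LB2 x : x \in L2 -> ~ B x.
    by rewrite mem_filter => /andP[xB _] Bx; rewrite mem_set in xB.
  have xiE : xi = of_seq (L1 ++ L2).
    by rewrite xiL; apply/eq_seq_msetP; rewrite perm_sym perm_filterC.
  exists (size L1, size L2); first by rewrite /= -(massE L1 L2)// -xiE.
  exists (seq_code L1), (seq_code L2); split.
  - by apply/sum_codesP; exists L1.
  - by apply/sum_codesP; exists L2.
  - rewrite xiE measure_code_of_seq; apply/funext => i.
    by rewrite /seq_code big_cat.
exists (of_seq (L ++ L')); first by rewrite /= massE// Lu.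
rewrite measure_code_of_seq; apply/funext => i.
by rewrite /seq_code big_cat.
Qed.

Lemma analytic_fcmass_event B (U : set nat) : borel B ->
  analytic (measure_code @` [set xi | U (fcmass xi B)]).
Proof.
move=> /(analytic_borel E_lc E_T2 openV baseV)[aB aCB].
rewrite fcmass_event_codes; apply: analytic_countable_bigcup => -[u v] _ /=.
by apply: analytic_sum; exact: analytic_sum_codes.
Qed.

Lemma analytic_measure_range : analytic (range measure_code).
Proof.
have -> : [set: fcmeasure E] = [set xi | [set: nat] (fcmass xi set0)] by [].
by apply: analytic_fcmass_event; exact: sigma_algebra0.
Qed.

Lemma analytic_measurable (A : set (fcmeasure E)) : measurable A ->
  analytic (measure_code @` A).
Proof.
move=> mA; suff [] : analytic (measure_code @` A) /\ analytic (measure_code @` ~` A) by [].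
move: A mA; apply: analytic_generated; first exact: measure_code_inj.
  exact: analytic_measure_range.
move=> _ [B [U [bB ->]]]; split; first exact: analytic_fcmass_event.
exact: (analytic_fcmass_event (~` U)).
Qed.

Lemma measurable_measure_code i v : measurable [set xi | measure_code xi i = v].
Proof.
have bV : borel (V i) by apply: sub_sigma_algebra; exact: openV.
exact: (measurable_fcmass_event [set v] bV).
Qed.

End measure_codes.

(** * Analyticity of the enlargement *)

Section enlargement.
Context {E : topologicalType} {R : realType}.
Implicit Types (xi nu : fcmeasure E) (A : set (fcmeasure E)) (alpha : E -> R).

Definition admissible xi alpha :=
  (forall x, 0 <= alpha x) /\ fcintegral xi (fun x => alpha x ^+ 2) <= 1.

Lemma not_enlargement A (s : R) xi : ~ enlargement A s xi ->
  exists2 alpha, admissible xi alpha &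
    forall nu, A nu -> s < fcintegral (fcdiff xi nu) alpha.
Proof.
move=> /negP; rewrite -ltNge => /ereal_sup_gt[_ [alpha adm <-] hs].
exists alpha => // nu Anu; rewrite -lte_fin; apply: lt_le_trans hs _.
by apply: ereal_inf_lbound; exists nu.
Qed.

(** A uniform gap is required: costs that all exceed [s] may still have infimum [s]. *)
Lemma enlargementPn A (s t : R) xi alpha : admissible xi alpha -> s < t ->
  (forall nu, A nu -> t <= fcintegral (fcdiff xi nu) alpha) -> ~ enlargement A s xi.
Proof.
move=> adm st tA; apply/negP; rewrite -ltNge.
apply: (@lt_le_trans _ _ t%:E); first by rewrite lte_fin.
apply: le_trans (ereal_sup_ubound _); last by exists alpha; [exact: adm|reflexivity].
by apply: le_ereal_inf_tmp => _ [nu Anu <-]; rewrite lee_fin tA.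
Qed.

Definition comb r (n : {ffun 'I_r -> nat}) (y : 'I_r -> E) : fcmeasure E :=
  of_seq (flatten [seq nseq (n i) (y i) | i <- enum 'I_r]).

Lemma big_comb r (n : {ffun 'I_r -> nat}) (y : 'I_r -> E) (f : E -> R) :
  \sum_(x <- flatten [seq nseq (n i) (y i) | i <- enum 'I_r]) f x =
  \sum_i (n i)%:R * f (y i).
Proof.
rewrite big_flatten big_map big_enum /=; apply: eq_bigr => i _.
by rewrite big_nseq iter_addr_0 mulr_natl.
Qed.

Lemma fcintegral_comb r (n : {ffun 'I_r -> nat}) (y : 'I_r -> E) (f : E -> R) :
  fcintegral (comb n y) f = \sum_i (n i)%:R * f (y i).
Proof. by rewrite fcintegral_of_seq big_comb. Qed.

Lemma combE r (n : {ffun 'I_r -> nat}) (y : 'I_r -> E) x :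
  (comb n y : multiset E) x = (\sum_i n i * (y i == x))%N.
Proof.
rewrite of_seqE count_flatten -map_comp sumnE big_map big_enum /=.
by apply: eq_bigr => i _; rewrite count_nseq mulnC.
Qed.

Lemma measure_code_comb V r (n : {ffun 'I_r -> nat}) (y : 'I_r -> E) :
  measure_code V (comb n y) = (fun k => \sum_i n i * point_code V (y i) k)%N.
Proof.
rewrite measure_code_of_seq; apply/funext => k.
rewrite /seq_code big_flatten big_map big_enum /=; apply: eq_bigr => i _.
by rewrite big_nseq iter_addn_0 mulnC.
Qed.

Lemma seq_gap (T : eqType) (G : seq T) (f : T -> R) (s : R) :
  (forall t, t \in G -> s < f t) -> exists2 d, s < d & forall t, t \in G -> d <= f t.
Proof.
elim: G => [|t G IH] sf; first by exists (s + 1); rewrite ?ltrDl.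
have [|d sd dG] := IH; first by move=> u uG; apply: sf; rewrite inE uG orbT.
exists (Num.min d (f t)); first by rewrite lt_min sd sf// inE eqxx.
by move=> u; rewrite inE ge_min => /orP[/eqP ->|/dG ->//]; rewrite lexx orbT.
Qed.

Section codes.
Context (E_lc : locally_compact [set: E])
  (E_T2 : hausdorff_space E) (V : nat -> set E) (openV : forall i, open (V i))
  (baseV : forall x U, nbhs x U -> exists2 i, V i x & V i `<=` U).

Definition down A r (t : {ffun 'I_r -> nat}) (y : 'I_r -> E) :=
  exists2 nu, A nu & exists mu : fcmeasure E,
    nu = ((comb t y : multiset E) `+` (mu : multiset E))%mset.

(** The difference of [xi] and [nu] depends on [nu] only through their minimum, one of finitely many
    submeasures of [xi]. So a finite list [G] of multiplicity vectors decides membership. The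
    combinatorial data [r], [n], [G] range over countable sets, and the positions [y] enter only
    through [down], the form from which analyticity can be read off. *)
Lemma enlargement_combP A (s : R) xi : enlargement A s xi <->
  exists r (n : {ffun 'I_r -> nat}) (G : seq {ffun 'I_r -> nat}) (y : 'I_r -> E),
    [/\ ~ separated s [set` G] [set n], xi = comb n y &
        forall t, t \in G -> down A t y].
Proof.
split=> [xiAs|[r [n [G [y [nsep -> GA]]]]]]; last first.
  apply: contrapT => /not_enlargement[alpha [a0 a1] sA]; apply: nsep => _ ->.
  exists (fun i => alpha (y i)) => //; split.
    by move: a1; rewrite fcintegral_comb.
  move=> t /= /GA[nu /sA + [mu nuE]] => /lt_le_trans; apply.
  pose diff : {ffun 'I_r -> nat} := [ffun i => (n i - t i)%N].
  apply: (@le_trans _ _ (fcintegral (comb diff y) alpha)).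
    apply: fcintegral_le => // x; rewrite /fcdiff nuE !msetE2 !combE.
    apply: (@leq_trans (\sum_i n i * (y i == x) - \sum_i t i * (y i == x)))%N.
      by rewrite leq_sub2l// leq_addr.
    rewrite leq_subLR -big_split /=; apply: leq_sum => i _.
    by rewrite -mulnDl leq_mul2r ffunE -maxnE leq_maxr orbT.
  by rewrite fcintegral_comb; apply: ler_sum => i _; rewrite ffunE mulrC.
pose S : seq E := finsupp (xi : multiset E); have uS : uniq S by exact: fset_uniq.
pose y (i : 'I_(size S)) : E := tnth (in_tuple S) i.
have y_inj : injective y.
  move=> i j; rewrite /y !(tnth_nth (y i)) /= => /eqP.
  by rewrite nth_uniq// => /eqP /val_inj.
pose n : {ffun 'I_(size S) -> nat} := [ffun i => (xi : multiset E) (y i)].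
pose M := (\sum_i n i)%N.
pose nats (u : {ffun 'I_(size S) -> 'I_M.+1}) : {ffun 'I_(size S) -> nat} :=
  [ffun i => val (u i)].
(* Capping the entries at the total mass [M] keeps the list finite, yet it contains the minimum of
   [xi] with every [nu] in [A]. *)
pose G := [seq t <- map nats (enum {: {ffun 'I_(size S) -> 'I_M.+1}}) |
  `[< down A t y >]].
have restrE (f : E -> nat) x :
    (\sum_i f (y i) * (y i == x) = if x \in S then f x else 0)%N.
  rewrite -(big_tnth _ _ S xpredT (fun z => f z * (z == x))%N).
  case: ifPn => xS.
    rewrite (bigD1_seq x)//= eqxx muln1 big1 ?addn0// => z /negPf ->.
    by rewrite muln0.
  rewrite big_seq big1// => z zS; case: eqP => [zx|_]; last by rewrite muln0.
  by rewrite -zx zS in xS.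
have xiE : xi = comb n y.
  apply: fcmeasureP => x; rewrite combE; under eq_bigr do rewrite ffunE.
  rewrite restrE; case: ifPn => //.
  by rewrite /S msuppE => /mset_eq0P.
exists (size S), n, G, y; split=> //; last first.
  by move=> t; rewrite mem_filter => /andP[/asboolP].
move=> /(_ n erefl)[alpha a0 [a1 sG]].
(* Finiteness of [G] turns the strict inequalities into the gap required by [enlargementPn]; [beta]
   below extends [alpha] by 0 off the atoms of [xi]. *)
have [t st tG] := seq_gap (fun t tG => sG t tG).
pose beta x := \sum_i alpha i * (y i == x)%:R.
have betaE i : beta (y i) = alpha i.
  rewrite /beta (bigD1 i)//= eqxx mulr1 big1 ?addr0// => j /negPf ji.
  by rewrite (inj_eq y_inj) ji mulr0.
have beta0 x : 0 <= beta x by apply: sumr_ge0 => i _; rewrite mulr_ge0.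
apply: (@enlargementPn A s t xi beta) => // [|nu Anu].
  split=> //; rewrite xiE fcintegral_comb; apply: le_trans a1.
  by apply: ler_sum => i _; rewrite betaE.
pose k : {ffun 'I_(size S) -> nat} := [ffun i => minn (n i) ((nu : multiset E) (y i))].
have kG : k \in G.
  rewrite mem_filter; apply/andP; split.
    apply/asboolP; exists nu => //.
    exists ((nu : multiset E) `\` (comb k y : multiset E))%mset.
    rewrite msetBDKC//; apply/msubsetP => x; rewrite combE.
    under eq_bigr do rewrite !ffunE.
    rewrite (restrE (fun x => minn ((xi : multiset E) x) ((nu : multiset E) x))).
    by case: ifP => // _; rewrite geq_minr.
  have kM i : (k i < M.+1)%N.
    rewrite ltnS ffunE; apply: leq_trans (geq_minl _ _) _.
    by rewrite /M (bigD1 i)//= leq_addr.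
  pose u : {ffun 'I_(size S) -> 'I_M.+1} := [ffun i => Ordinal (kM i)].
  rewrite (_ : k = nats u); first by apply: map_f; rewrite mem_enum.
  by apply/ffunP => i; rewrite [in RHS]ffunE [u i]ffunE.
apply: le_trans (tG _ kG) _; rewrite fcintegral_fcdiff -/S.
rewrite [leRHS](big_tnth _ _ S xpredT) le_eqVlt; apply/orP; left; apply/eqP.
apply: eq_bigr => i _; rewrite -/(y i) betaE mulrC !ffunE; congr (_%:R * _).
by rewrite minnE subKn// leq_subr.
Qed.

Lemma analytic_enlargement A (s : R) : measurable A ->
  analytic (measure_code V @` enlargement A s).
Proof.
move=> mA; have aA := analytic_measurable E_lc E_T2 openV baseV mA.
have aT := analytic_measure_range E_lc E_T2 openV baseV.
have aP := analytic_point_range E_lc E_T2 openV baseV.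
have mc_inj := measure_code_inj E_T2 baseV.
have sl := baire_continuous_slice.
pose add01 g : baire := fun k => (slice 0 g k + slice 1 g k)%N.
have cadd : baire_continuous add01 by exact: baire_continuous_add.
(* Codes of measures dominated by a member of [A]: slice 1 holds the remainder, which is projected
   away. *)
pose D : set baire := slice 0 @` (slice 1 @^-1` range (measure_code V) `&`
  add01 @^-1` (measure_code V @` A)).
have aD : analytic D.
  by apply: analytic_image => //; apply: analyticI; exact: analytic_preimage.
have DP xi : D (measure_code V xi) <-> exists2 nu, A nu & exists mu : fcmeasure E,
    nu = ((xi : multiset E) `+` (mu : multiset E))%mset.
  split=> [[g [[mu _ mug] [nu Anu nug]] gxi]|[nu Anu [mu nuE]]].
    exists nu => //; exists mu; apply: mc_inj.
    by rewrite nug measure_codeD mug -gxi.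
  exists (merge_slices (fun k => measure_code V (if k is 0%N then xi else mu))).
    split; first by exists mu => //; rewrite slice_merge.
    by exists nu => //; rewrite nuE measure_codeD /add01 !slice_merge.
  by rewrite slice_merge.
pose cc r (t : {ffun 'I_r -> nat}) g : baire :=
  fun k => (\sum_i t i * slice i g k)%N.
have ccc r t : baire_continuous (@cc r t).
  by apply: (@baire_continuous_sum _ _ t (fun i : 'I_r => slice i)).
(* The condition [~ separated] involves no points of [E]: it only selects indices of a countable
   union. *)
have -> : measure_code V @` enlargement A s =
  \bigcup_r \bigcup_(nG in [set nG : {ffun 'I_r -> nat} * seq {ffun 'I_r -> nat} |
      ~ separated s [set` nG.2] [set nG.1]])
    (cc r nG.1 @` ((\bigcap_(i in [set: 'I_r]) slice i @^-1` range (point_code V)) `&`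
      (\bigcap_(t in [set` nG.2]) cc r t @^-1` D))).
  have ccE r (t : {ffun 'I_r -> nat}) g (y : 'I_r -> E) :
      (forall i : 'I_r, slice i g = point_code V (y i)) ->
      cc r t g = measure_code V (comb t y).
    move=> gy; rewrite measure_code_comb; apply/funext => k.
    by apply: eq_bigr => i _; rewrite gy.
  apply/seteqP; split.
    move=> _ [xi /enlargement_combP[r [n [G [y [nsep -> GA]]]]] <-].
    exists r => //; exists (n, G) => //.
    pose g := merge_slices (fun k => if (insub k : option 'I_r) is Some i then
      point_code V (y i) else fun=> 0%N).
    have gE (i : 'I_r) : slice i g = point_code V (y i) by rewrite /g slice_merge valK.
    exists g; last exact: ccE.
    split=> [i _|t tG]; first by exists (y i).
    by rewrite /= (ccE _ _ _ y)//; apply/DP; exact: GA.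
  move=> _ [r _ [[n G] /= nsep [g [gP gD] <-]]].
  have /choice[y yP] : forall i : 'I_r, exists x, point_code V x = slice i g.
    by move=> i; have [x _ xg] := gP i I; exists x.
  have yP' (i : 'I_r) : slice i g = point_code V (y i) by rewrite yP.
  exists (comb n y); last by rewrite (ccE _ _ _ y).
  apply/enlargement_combP; exists r, n, G, y; split=> // t tG.
  by apply/DP; rewrite -(ccE _ _ g)//; exact: gD.
apply: analytic_countable_bigcup => r _.
apply: analytic_countable_bigcup => -[n G] _ /=.
apply: analytic_image => //; apply: analyticI.
  by apply: analytic_countable_bigcap => i _; exact: analytic_preimage.
by apply: analytic_countable_bigcap => t _; exact: analytic_preimage.
Qed.

End codes.

End enlargement.

Lemma completed_algebra_genC {d : measure_display} {T : measurableType d}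
    {R : realType} (mu : probability T R) (S : set T) :
  completed_algebra_gen mu S -> completed_algebra_gen mu (~` S).
Proof.
move=> [B mB [N [M [mM M0 NM]] <-]].
exists (~` B `\` M); first by apply: measurableD => //; exact: measurableC.
exists (~` (B `|` N) `&` M); first by exists M; split=> // x [].
apply/seteqP; split=> x /=; first by move=> [[nB nM] [//|/NM]|[]].
by move=> nS; have [Mx|nMx] := pselect (M x); [right|left; split=> // Bx; apply: nS; left].
Qed.

(** * The inequality *)

Section cells.
Context {E : topologicalType} (V : nat -> set E) (openV : forall i, open (V i)).

Definition pattern n (x : E) : {ffun 'I_n -> bool} := [ffun i : 'I_n => x \in V i].

(** The atoms of the algebra generated by the first [n] base sets, possibly empty. *)
Definition cell n (c : {ffun 'I_n -> bool}) : set E := [set x | pattern n x = c].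

Lemma borel_cell n (c : {ffun 'I_n -> bool}) : borel (cell c).
Proof.
have -> : cell c = ~` \bigcup_k (if (insub k : option 'I_n) is Some i
    then if c i then ~` V i else V i else set0).
  apply/seteqP; split=> [x <- [k _]|x xV].
    case: insubP => // i _ _; rewrite ffunE.
    by case: ifPn => [/set_mem|/[swap] Vx]; rewrite ?mem_set.
  apply/ffunP => i; rewrite ffunE; apply: contrapT => xi; apply: xV; exists i => //.
  rewrite valK; move: xi; case: (c i) => xi; first by move=> Vx; apply: xi; rewrite mem_set.
  by have [/set_mem//|xV] := boolP (x \in V i); case: xi; exact/negbTE.
have borelC B : borel B -> borel (~` B) by move=> bB; rewrite -setTD; exact: sigma_algebraCD.
apply: (borelC); apply: sigma_algebra_bigcup => k.
have bV i : borel (V i) by apply: sub_sigma_algebra; exact: openV.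
case: insubP => [i _ _|_]; last exact: sigma_algebra0.
by case: (c i); [exact: borelC|exact: bV].
Qed.

Lemma trivIset_cell n : trivIset [set: {ffun 'I_n -> bool}] (@cell n).
Proof. by move=> c c' _ _ [x [<- <-]]. Qed.

(** Turns conditions on the first [n] code coordinates into conditions on cell counts, to which
    [talagrand_cells] applies. *)
Lemma measure_code_cells n xi (i : 'I_n) : measure_code V xi i =
  (\sum_(c : {ffun 'I_n -> bool} | c i) cell_counts (@cell n) xi c)%N.
Proof.
have [L ->] := of_seq_surj xi; rewrite /measure_code fcmass_of_seq.
under [RHS]eq_bigr do rewrite ffunE fcmass_of_seq.
rewrite exchange_big /=; apply: eq_bigr => x _.
have cE c : (x \in cell c) = (c == pattern n x).
  by apply/idP/eqP => [/set_mem <-|->]; rewrite ?mem_set.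
under eq_bigr do rewrite cE.
rewrite big_mkcond (bigD1 (pattern n x))//= eqxx ffunE big1 ?addn0.
  by case: (_ \in _).
by move=> c /negPf ->; case: ifP.
Qed.

End cells.

Section inequality.
Context {R : realType} {E : topologicalType} (E_T2 : hausdorff_space E)
  (V : nat -> set E) (openV : forall i, open (V i))
  (baseV : forall x U, nbhs x U -> exists2 i, V i x & V i `<=` U)
  {d : measure_display} {Omega : measurableType d} (P : probability Omega R)
  (eta : {RV P >-> fcmeasure E}) (eta_poisson : finite_poisson_process eta)
  (A : set (fcmeasure E)) (s : R) (s_ge0 : 0 <= s)
  (F : set baire) (phi : baire -> baire) (bnd : baire)
  (F_closed : baire_closed F) (phi_cont : baire_continuous phi)
  (AF : measure_code V @` A = phi @` F).

Let near_counts n : set {ffun {ffun 'I_n -> bool} -> nat} :=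
  [set nu | exists h, [/\ F h, forall i, (i < n)%N -> (h i <= bnd i)%N &
    forall i : 'I_n, phi h i = (\sum_(c : {ffun 'I_n -> bool} | c i) nu c)%N]].

Let far_counts n : set {ffun {ffun 'I_n -> bool} -> nat} :=
  [set xi | exists2 alpha : {ffun 'I_n -> bool} -> R, (forall c, 0 <= alpha c) &
    sqnorm alpha xi <= 1 /\ forall nu, @near_counts n nu -> s < cost alpha xi nu].

Let far n : set (fcmeasure E) :=
  [set xi | @far_counts n (cell_counts (@cell _ V n) xi)].

Let approxE n : approx (measure_code V) F phi bnd n =
  [set xi | @near_counts n (cell_counts (@cell _ V n) xi)].
Proof.
apply/seteqP; split=> xi [h [Fh hb hxi]]; exists h; split=> //.
  by move=> i; rewrite hxi// measure_code_cells.
by move=> i i_n; rewrite (hxi (Ordinal i_n)) -measure_code_cells.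
Qed.

Let measurable_far n : measurable (far n).
Proof. by apply: measurable_cell_counts => c; exact: borel_cell. Qed.

Let far_le n : (distribution P eta (approx (measure_code V) F phi bnd n) *
  distribution P eta (far n) <= (expR (- (s ^+ 2 / 4)))%:E)%E.
Proof.
rewrite approxE; apply: (talagrand_cells eta_poisson) => //.
- by move=> c; exact: borel_cell.
- exact: trivIset_cell.
Qed.

(* An admissible [alpha] witnessing that [xi] is far from [A] is constant on
   fine enough cells; if it failed to be a witness at infinitely many levels,
   compactness would produce the code of a measure in [A] close to [xi]. *)
Let far_eventually xi : ~ enlargement A s xi ->
  exists N, forall n, (N <= n)%N -> far n xi.
Proof.
move=> /not_enlargement[alpha [a0 a1] sA]; apply: contrapT => often.
pose S : seq E := finsupp (xi : multiset E); have uS : uniq S by exact: fset_uniq.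
have bounded (j : E -> nat) : exists n, forall x, x \in S -> (j x < n)%N.
  exists (\sum_(x <- S) j x).+1%N => x xS.
  by rewrite ltnS (big_rem x)//= leq_addr.
have /choice[iso isoP] : forall x, exists i,
    V i x /\ forall y, y \in S -> V i y -> y = x.
  by move=> x; have [i ? ?] := base_isolates E_T2 baseV S x; exists i.
have [n0 n0P] := bounded iso.
(* The sum is the cost against the measure coded by [phi h], with its multiplicity at [x] replaced
   by the mass of a base set around [x]. All choices [j] with indices below [n] are included,
   because the one that isolates the atoms of the limit measure is known only once that measure has
   been found. *)
pose close n : set baire := [set h | [/\ F h,
  forall i, (i < n)%N -> (h i <= bnd i)%N &
  forall j : E -> nat, (forall x, x \in S -> V (j x) x /\ (j x < n)%N) ->
    \sum_(x <- S) ((xi : multiset E) x - phi h (j x))%:R * alpha x <= s]].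
have close_closed n : baire_closed (close n).
  move=> g gC; split.
  - by apply: F_closed => m; have [h [Fh _ _] gh] := gC m; exists h.
  - by move=> i i_n; have [h [_ hb _] gh] := gC i.+1; rewrite gh//; exact: hb.
  - move=> j jP; have [m hm] := baire_continuous_agree g n phi_cont.
    have [h [_ _ hs] /hm gh] := gC m; apply: le_trans (hs j jP).
    rewrite big_seq [leRHS]big_seq; apply: ler_sum => x /jP[_ jn].
    by rewrite gh.
have close_decr m n : (m <= n)%N -> close n `<=` close m.
  move=> mn h [Fh hb hs]; split=> //.
    by move=> i im; apply: hb; exact: leq_trans mn.
  move=> j jP; apply: hs => x /jP[? jm]; split=> //; exact: leq_trans mn.
have close_bnd n h : close n h -> forall i, (i < n)%N -> (h i <= bnd i)%N by case.
have close0 n : close n !=set0.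
  have [m [nm nfar]] : exists m, (maxn n n0 <= m)%N /\ ~ far m xi.
    apply: contrapT => nm; apply: often; exists (maxn n n0) => m nm'.
    by apply: contrapT => nfar; apply: nm; exists m.
  move: nm; rewrite geq_max => /andP[nm n0m].
  suff [h hm] : close m !=set0 by exists h; exact: close_decr hm.
  (* Since [m >= n0], the isolating base sets are among the first [m], so the cells separate the
     atoms of [xi]. *)
  have pat_inj x y : x \in S -> y \in S -> pattern V m x = pattern V m y -> y = x.
    move=> xS yS pxy; have [Vx isox] := isoP x; apply: isox => //.
    have /ffunP/(_ (Ordinal (leq_trans (n0P x xS) n0m))) := pxy.
    by rewrite !ffunE /= mem_set// => /esym/set_mem.
  have sumE (f : E -> R) c x : x \in S -> pattern V m x = c ->
      \sum_(y <- S | pattern V m y == c) f y = f x.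
    move=> xS xc; rewrite big_mkcond (bigD1_seq x)//= xc eqxx big_seq_cond.
    rewrite big1 ?addr0// => y /andP[yS yx]; case: eqP => // yc.
    by move: yx; rewrite (pat_inj x y)// ?eqxx// xc yc.
  have sum0 (f : E -> R) c : ~ (exists2 x, x \in S & pattern V m x = c) ->
      \sum_(y <- S | pattern V m y == c) f y = 0.
    move=> nx; rewrite big_seq_cond big1// => y /andP[yS /eqP yc].
    by exfalso; apply: nx; exists y.
  have countE x : x \in S ->
      cell_counts (@cell _ V m) xi (pattern V m x) = (xi : multiset E) x.
    move=> xS; rewrite ffunE; apply: fcmass_isolated => // y yS yx.
    exact: pat_inj.
  pose beta c := \sum_(x <- S | pattern V m x == c) alpha x.
  have beta0 c : 0 <= beta c by exact: sumr_ge0.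
  have beta1 : sqnorm beta (cell_counts (@cell _ V m) xi) <= 1.
    apply: le_trans a1; rewrite /fcintegral -/S.
    rewrite [leRHS](partition_big (pattern V m) xpredT)//=.
    apply: ler_sum => c _.
    have [[x xS xc]|nx] := pselect (exists2 x, x \in S & pattern V m x = c).
      by rewrite /beta !(sumE _ _ x)// -xc countE.
    by rewrite /beta !sum0// expr0n mulr0.
  have [nu [h [Fh hb hnu]] hs] : exists2 nu, @near_counts m nu &
      cost beta (cell_counts (@cell _ V m) xi) nu <= s.
    apply: contrapT => nnu; apply: nfar; exists beta => //; split=> // nu nunear.
    by rewrite ltNge; apply/negP => nus; apply: nnu; exists nu.
  exists h; split=> // j jP; apply: le_trans hs.
  (* The cell of [x] lies inside [V (j x)], so passing from the base set to the cell can only raise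
     the cost. *)
  apply: (@le_trans _ _ (\sum_(x <- S)
      ((xi : multiset E) x - nu (pattern V m x))%:R * alpha x)).
    rewrite big_seq [leRHS]big_seq; apply: ler_sum => x /jP[Vx jm].
    apply: ler_wpM2r => //; rewrite ler_nat leq_sub2l// (hnu (Ordinal jm)).
    by rewrite (bigD1 (pattern V m x)) ?leq_addr//= ffunE mem_set.
  rewrite (partition_big (pattern V m) xpredT)//=; apply: ler_sum => c _.
  have [[x xS xc]|nx] := pselect (exists2 x, x \in S & pattern V m x = c).
    by rewrite /beta !(sumE _ _ x)// -xc countE// mulrC.
  by rewrite /beta !sum0// mul0r.
have [h hclose] := baire_compact close_closed close_decr close_bnd close0.
have : (phi @` F) (phi h) by have [Fh _ _] := hclose 0%N; exists h.
rewrite -AF => -[nu Anu nuh].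
(* With base sets that isolate each [x] among the atoms of [nu], the sum in [close] becomes the true
   cost, which exceeds [s]. *)
have /choice[j jP] : forall x, exists i,
    V i x /\ fcmass nu (V i) = (nu : multiset E) x.
  move=> x; have [i Vix isoi] := base_isolates E_T2 baseV (finsupp (nu : multiset E)) x.
  by exists i; split=> //; exact: fcmass_isolated.
have [n jn] := bounded j.
have [_ _ /(_ j)] := hclose n.
have -> : \sum_(x <- S) ((xi : multiset E) x - phi h (j x))%:R * alpha x =
    fcintegral (fcdiff xi nu) alpha.
  rewrite fcintegral_fcdiff; apply: eq_bigr => x _.
  by rewrite -nuh /measure_code (jP x).2.
rewrite leNgt sA// => h0; have : false by apply: h0 => x xS; split; [case: (jP x)|exact: jn].
by [].
Qed.

(** Each [far n] has measure at most the exponential divided by [c], and a measure outside the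
    enlargement is eventually far; the lim inf of the events [far n] is therefore a measurable
    cover. *)
Lemma outer_far_le (c : R) : 0 < c ->
  (forall n, c%:E < distribution P eta (approx (measure_code V) F phi bnd n))%E ->
  exists L, [/\ measurable L, ~` enlargement A s `<=` L &
    (distribution P eta L <= (expR (- (s ^+ 2 / 4)) / c)%:E)%E].
Proof.
move=> c0 cK.
have far_c n : (distribution P eta (far n) <= (expR (- (s ^+ 2 / 4)) / c)%:E)%E.
  have mf : distribution P eta (far n) \is a fin_num by exact: fin_num_measure.
  rewrite -(fineK mf) lee_fin ler_pdivlMr// mulrC -lee_fin EFinM (fineK mf).
  apply: le_trans (far_le n); apply: lee_wpmul2r; first exact: measure_ge0.
  exact/ltW/cK.
have [mL Lc] := measure_liminf_le measurable_far far_c.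
exists (\bigcup_n \bigcap_(m in [set m | (n <= m)%N]) far m); split=> //.
by move=> xi /far_eventually[N farN]; exists N.
Qed.

End inequality.

Unset Implicit Arguments.

Theorem theorem1p1 (R : realType) (E : topologicalType)
  (E_lc : locally_compact [set: E]) (E_sc : @second_countable E)
  (E_T2 : hausdorff_space E)
  (d : measure_display) (Omega : measurableType d) (P : probability Omega R)
  (eta : {RV P >-> fcmeasure E}) (eta_poisson : finite_poisson_process eta)
  (A : set (fcmeasure E)) (mA : measurable A) (s : R) (s_ge0 : 0 <= s) :
  completed_algebra_gen (distribution P eta) (~` enlargement A s) /\
  (P [set w | A (eta w)] *
     completed_prob (distribution P eta) (~` enlargement A s)
   <= (expR (- (s ^+ 2 / 4)))%:E)%E.
Proof.
have [V [openV baseV]] := countable_base E_sc.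
set mu := distribution P eta.
have mV := measurable_measure_code openV.
have V_inj := measure_code_inj E_T2 baseV.
have [F [phi [cF cphi AF]]] := analytic_measurable E_lc E_T2 openV baseV mA.
split.
  apply: (@completed_algebra_genC _ _ _ mu).
  apply: (@analytic_completed _ _ _ mu _ mV V_inj).
  exact: (analytic_enlargement E_lc E_T2 openV baseV s mA).
set e := expR _.
have outer_le L : measurable L -> ~` enlargement A s `<=` L ->
    (completed_prob mu (~` enlargement A s) <= mu L)%E.
  move=> mL SL; have <- : completed_prob mu L = mu L by exact: measurable_mu_extE.
  exact: le_mu_ext.
have m_ge0 : (0 <= completed_prob mu (~` enlargement A s))%E by exact: mu_ext_ge0.
have m_le1 := outer_le _ measurableT (@subsetT _ _).
rewrite -/(mu A).
have muA : mu A \is a fin_num by exact: fin_num_measure.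
have [m mE] : exists m : R, completed_prob mu (~` enlargement A s) = m%:E.
  exists (fine (completed_prob mu (~` enlargement A s))); rewrite fineK//.
  rewrite ge0_fin_numE//; apply: le_lt_trans m_le1 _.
  by rewrite ltey_eq fin_num_measure.
have [a aE] : exists a : R, mu A = a%:E by exists (fine (mu A)); rewrite fineK.
(* Inner approximation keeps only a mass above [c] of [A], for any [c < a]. If [a * m] exceeded [e],
   the midpoint of [e / m] and [a] would be a value of [c] violating this bound. *)
have hc c : 0 < c -> c < a -> c * m <= e.
  move=> c0 ca.
  have [|bnd bndP] := approx_outer_gt mV (analytic_codedE V_inj AF) (c := c) (mu := mu).
    move=> H mH AH; apply: (@lt_le_trans _ _ (mu A)); first by rewrite aE lte_fin.
    by apply: le_measure; rewrite ?inE.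
  have [L [mL SL Le]] := outer_far_le E_T2 openV baseV eta_poisson s_ge0 cF cphi AF c0 bndP.
  have := le_trans (outer_le _ mL SL) Le.
  by rewrite mE lee_fin ler_pdivlMr// mulrC.
rewrite mE in m_ge0 *; rewrite lee_fin in m_ge0.
rewrite (_ : P [set w | A (eta w)] = a%:E)// -EFinM lee_fin.
have e0 : 0 <= e by exact: expR_ge0.
rewrite leNgt; apply/negP => eam.
have m0 : 0 < m.
  by rewrite lt_neqAle m_ge0 andbT; apply: contraTneq eam => <-; rewrite mulr0 -leNgt.
have em : e / m < a by rewrite ltr_pdivrMr.
have em0 : 0 <= e / m by rewrite divr_ge0// ltW.
have := hc ((e / m + a) / 2); rewrite -ler_pdivlMr//.
lra.
Qed.
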